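(* For a countable ring $R$, the following are equivalent: $R$ is an $F$-ring; $R$ is a $P$-ring; $R$ is left perfect and right coherent. In this case $R^{\omega}\cong({}_RR)^{(\mathfrak c)}$ as left $R$-modules.
   Context: Rings have an identity $1\neq 0$; modules are unital left modules unless stated otherwise. $R^\omega=({}_RR)^\omega$ is the direct product of countably many copies of the left regular module, $({}_RR)^{(\mathfrak c)}$ is the direct sum of $\mathfrak c=2^{\aleph_0}$ copies. $R$ is an $F$-ring if the left $R$-module $R^\omega$ is free, and a $P$-ring if the left $R$-module $R^\omega$ is projective. $R$ is left perfect if every left $R$-module has a projective cover (equivalently, every descending chain of principal right ideals stabilizes). $R$ is right coherent if every finitely generated right ideal is finitely presented. *)

(* Defs.v *)
From HB Require Import structures.
From mathcomp Require Import all_boot all_order all_algebra.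
From mathcomp Require Import mathcomp_extra boolp classical_sets functions cardinality.

Set Implicit Arguments.
Unset Strict Implicit.
Unset Printing Implicit Defensive.

Import GRing.Theory.
Local Open Scope classical_set_scope.
Local Open Scope ring_scope.

(* [lmodType R] is the type of left R-modules, and [R^o] is the left regular
   module.  Right R-modules are left modules over the converse ring [R^c]. *)

Definition module_iso (R : nzRingType) (M N : lmodType R) : Prop :=
  exists f : {linear M -> N}, bijective f.

(* The direct product of countably many copies of R: functions nat -> R with
   the pointwise operations. *)
Definition Romega (R : nzRingType) : lmodType R := (nat -> R^o).

(* The direct sum of I copies of M: finitely supported functions I -> M with the
   pointwise operations. *)
Definition finsupp (R : nzRingType) (I : Type) (M : lmodType R) :
    {pred (I -> M)} :=
  fun f => `[< finite_set [set i | f i <> 0] >].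

Lemma finsupp_submod_closed (R : nzRingType) (I : Type) (M : lmodType R) :
  submod_closed (@finsupp R I M).
Proof.
split=> [|a f g /asboolP fF /asboolP gF]; apply/asboolP.
  by rewrite (_ : mkset _ = set0)//; apply/seteqP; split => i //=.
have FG := conj fF gF; rewrite -finite_setU in FG.
apply: sub_finite_set FG => i /= h; apply: contrapT => /not_orP[/= fi gi].
apply: h; move: fi gi => /contrapT fi /contrapT gi.
by rewrite -[LHS]/(a *: f i + g i) fi gi scaler0 addr0.
Qed.

HB.instance Definition _ (R : nzRingType) (I : Type) (M : lmodType R) :=
  GRing.isSubmodClosed.Build R (I -> M) (@finsupp R I M)
    (@finsupp_submod_closed R I M).

Definition dirsum (R : nzRingType) (I : Type) (M : lmodType R) : Type :=
  {f : I -> M | f \in @finsupp R I M}.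

HB.instance Definition _ (R : nzRingType) (I : Type) (M : lmodType R) :=
  SubType.on (dirsum I M).
HB.instance Definition _ (R : nzRingType) (I : Type) (M : lmodType R) :=
  [Choice of dirsum I M by <:].
HB.instance Definition _ (R : nzRingType) (I : Type) (M : lmodType R) :=
  [SubChoice_isSubLmodule of dirsum I M by <:].

Definition free_module (R : nzRingType) (M : lmodType R) : Prop :=
  exists I : Type, module_iso M (dirsum I R^o).

Definition projective (R : nzRingType) (P : lmodType R) : Prop :=
  forall (A B : lmodType R) (g : {linear A -> B}) (f : {linear P -> B}),
    (forall b, exists a, g a = b) ->
    exists h : {linear P -> A}, forall x, g (h x) = f x.

Definition F_ring (R : nzRingType) : Prop := free_module (Romega R).

Definition P_ring (R : nzRingType) : Prop := projective (Romega R).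

(* K is superfluous in M: N + K = M implies N = M, for every submodule N. *)
Definition superfluous (R : nzRingType) (M : lmodType R) (K : set M) : Prop :=
  forall N : {pred M}, submod_closed N ->
    (forall x, exists u v, [/\ u \in N, K v & x = u + v]) ->
    forall x, x \in N.

Definition projective_cover (R : nzRingType) (P M : lmodType R)
    (p : {linear P -> M}) : Prop :=
  [/\ projective P, (forall y, exists x, p x = y)
    & superfluous [set x | p x = 0]].

Definition left_perfect (R : nzRingType) : Prop :=
  forall M : lmodType R,
    exists (P : lmodType R) (p : {linear P -> M}), projective_cover p.

Definition lincomb (S : nzRingType) (M : lmodType S) (n : nat) (g : 'I_n -> M)
    (c : 'rV[S]_n) : M :=
  \sum_(i < n) c 0 i *: g i.

(* Submodules of M are given as sets. *)
Definition finitely_generated (S : nzRingType) (M : lmodType S) (N : set M) :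
    Prop :=
  exists (n : nat) (g : 'I_n -> M), N = range (lincomb g).

(* Exactness of S^m -> S^n -> N -> 0: N has finitely many generators whose
   module of relations is finitely generated. *)
Definition finitely_presented (S : nzRingType) (M : lmodType S) (N : set M) :
    Prop :=
  exists (n : nat) (g : 'I_n -> M),
    N = range (lincomb g) /\
    finitely_generated [set c : 'rV[S]_n | lincomb g c = 0].

(* Right ideals of R are the submodules of the left regular R^c-module. *)
Definition right_coherent (R : nzRingType) : Prop :=
  forall I : set (R^c)^o, finitely_generated I -> finitely_presented I.

(* Main.v *)
From HB Require Import structures.
Require Import Defs.
From mathcomp Require Import all_boot all_order all_algebra.
From mathcomp Require Import mathcomp_extra boolp classical_sets functions cardinality.
From mathcomp Require Import fsbigop.

(** Write J for the Jacobson radical of R, F for the free module of rank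
    continuum, and call J T-nilpotent when every sequence in J has a vanishing
    initial product a_0 ... a_(n-1).  T-nilpotence gives a Nakayama lemma
    without any finiteness hypothesis ([nakayama]): a submodule N of M with
    N + JM = M is M.  This replaces finite generation in all that follows about
    projective covers and surjectivity.

    Suppose that R^omega is projective.  Choose a dual basis: every y in
    R^omega is a finite combination of vectors u_s with coefficients given by
    linear coordinates of y.

    - Coherence ([P_ring_right_coherent]).  A finitely generated right ideal
      has countably many relations among its generators; listing them gives
      vectors of R^omega, and the finitely many coordinates of those vectors
      in a dual basis generate all the relations.

    - Descending chains ([P_ring_dcc]), after Chase.  If x_0 R > x_1 R > ... is
      strictly decreasing, a gliding hump argument shows that for some n all
      but finitely many coordinates of x_n y, for y supported beyond n, lie in
      x_(n+1) R.  The exceptional coordinates take countably many values,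
      whereas there are uncountably many 0/1 vectors y; two of them agree on
      these coordinates, and their difference puts x_n in x_(n+1) R.

    - Projective covers ([dcc_left_perfect]), after Bass.  The chain condition
      makes J T-nilpotent, provides nonzero idempotents in every right ideal
      that is not nil, and makes e R e local for e primitive.  In any module M a
      maximal family of elements e_i m_i with e_i primitive that is independent modulo
      JM yields a map from the sum of the R e_i to M; it is onto by Nakayama's
      lemma and its kernel lies in the radical, so it is superfluous.

    - The isomorphism R^omega = F ([Romega_iso_free]).  R^omega has only
      continuum many elements, so it is a quotient, hence a summand, of F.
      Conversely the indicators of the branches of the binary tree form a
      family of continuum many vectors independent modulo J; completing
      it modulo J and lifting gives a map from R^omega onto F, so F is a summand
      of R^omega.  Since F is isomorphic to a direct sum of countably many
      copies of itself, the decomposition method of Pelczynski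
      ([mutual_summands_iso]) concludes.

    Conversely let R be left perfect and right coherent
    ([perfect_coherent_P_ring]).  Applied to the direct limit of
    R -a_0-> R -a_1-> ..., perfection shows that J is T-nilpotent.  Let K be the
    kernel of a projective cover P of R^omega.  Coherence makes R^omega flat,
    in the elementary form that every k in K is a combination of elements of K
    with the coordinates of k in P as coefficients ([kernel_pure]).
    Those coordinates are in J as K is superfluous, so K = JK and K = 0. *)

Set Implicit Arguments.
Unset Strict Implicit.
Unset Printing Implicit Defensive.

Import GRing.Theory.

Local Open Scope classical_set_scope.
Local Open Scope ring_scope.

(** * Linear maps, submodules and kernels *)

Section Linear.
Variable R : nzRingType.
Implicit Types L M N : lmodType R.

Definition linear_of M N (f : M -> N) (linf : linear f) : {linear M -> N} :=
  HB.pack f (GRing.isLinear.Build R M N *:%R f linf).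

Definition submodule M (N : set M) :=
  N 0 /\ forall a x y, N x -> N y -> N (a *: x + y).

Lemma submodule0 M (N : set M) : submodule N -> N 0.
Proof. by case. Qed.

Lemma submoduleD M (N : set M) x y : submodule N -> N x -> N y -> N (x + y).
Proof. by move=> [_ +] Nx Ny => /(_ 1 x y Nx Ny); rewrite scale1r. Qed.

Lemma submoduleZ M (N : set M) a x : submodule N -> N x -> N (a *: x).
Proof. by move=> [N0 +] Nx => /(_ a x 0 Nx N0); rewrite addr0. Qed.

Lemma submoduleB M (N : set M) x y : submodule N -> N x -> N y -> N (x - y).
Proof.
move=> sN Nx Ny; apply: submoduleD => //.
by rewrite -scaleN1r; apply: submoduleZ.
Qed.

Lemma submodule_sum M (N : set M) (J : eqType) (s : seq J) (F : J -> M) :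
  submodule N -> (forall j, j \in s -> N (F j)) -> N (\sum_(j <- s) F j).
Proof.
move=> sN NF; rewrite big_seq; elim/big_ind: _ => //.
- exact: submodule0.
- by move=> x y; apply: submoduleD.
Qed.

Lemma submodule_preim L M (f : {linear L -> M}) (N : set M) :
  submodule N -> submodule [set x | N (f x)].
Proof.
move=> [N0 sN]; split=> [|a x y Nx Ny] /=; first by rewrite linear0.
by rewrite linearP; apply: sN.
Qed.

Lemma submodule_range L M (f : {linear L -> M}) : submodule (range f).
Proof.
split; first by exists 0; rewrite ?linear0.
by move=> a _ _ [x _ <-] [y _ <-]; exists (a *: x + y); rewrite ?linearP.
Qed.

Definition kernel M N (g : {linear M -> N}) : {pred M} := fun x => g x == 0.

Lemma kernel_submod_closed M N (g : {linear M -> N}) : submod_closed (kernel g).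
Proof.
split=> [|a x y]; rewrite !unfold_in ?linear0 // linearP.
by move=> /eqP -> /eqP ->; rewrite scaler0 addr0.
Qed.

HB.instance Definition _ M N (g : {linear M -> N}) :=
  GRing.isSubmodClosed.Build R M (kernel g) (kernel_submod_closed g).

Definition kernel_mod M N (g : {linear M -> N}) : Type :=
  {x : M | x \in kernel g}.

HB.instance Definition _ M N (g : {linear M -> N}) :=
  SubType.on (kernel_mod g).
HB.instance Definition _ M N (g : {linear M -> N}) :=
  [Choice of kernel_mod g by <:].
HB.instance Definition _ M N (g : {linear M -> N}) :=
  [SubChoice_isSubLmodule of kernel_mod g by <:].

Definition kernel_val M N (g : {linear M -> N}) (x : kernel_mod g) : M := val x.
Arguments kernel_val : simpl never.

Lemma kernel_val_is_linear M N (g : {linear M -> N}) : linear (@kernel_val M N g).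
Proof. by move=> a x y; rewrite /kernel_val linearP. Qed.

HB.instance Definition _ M N (g : {linear M -> N}) :=
  GRing.isLinear.Build R (kernel_mod g) M *:%R (@kernel_val M N g)
    (@kernel_val_is_linear M N g).

Lemma kernel_val_inj M N (g : {linear M -> N}) : injective (@kernel_val M N g).
Proof. exact: val_inj. Qed.

Lemma kernel_valP M N (g : {linear M -> N}) (x : kernel_mod g) :
  g (kernel_val x) = 0.
Proof. by apply/eqP; have := valP x. Qed.

Lemma kernel_mod_lift M N (g : {linear M -> N}) x : g x = 0 ->
  exists y : kernel_mod g, kernel_val y = x.
Proof.
move=> gx; have xk : x \in kernel g by rewrite unfold_in gx.
by exists (Sub x xk); rewrite /kernel_val SubK.
Qed.

Lemma kernel_mod_corestrict L M N (g : {linear M -> N}) (f : {linear L -> M}) :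
  (forall x, g (f x) = 0) -> exists h : {linear L -> kernel_mod g},
    forall x, kernel_val (h x) = f x.
Proof.
move=> gf0; have [h hE] := choice (fun x => kernel_mod_lift (gf0 x)).
have linh : linear h.
  by move=> a x y; apply: kernel_val_inj; rewrite hE !linearP /= !hE.
by exists (linear_of linh).
Qed.

End Linear.

(** * Direct sums and free modules *)

Section DirectSum.
Variables (R : nzRingType) (I : Type).
Implicit Types M : lmodType R.

Definition dcoord M i (c : dirsum I M) : M := val c i.
Arguments dcoord : simpl never.

Lemma dcoord_is_linear M i : linear (@dcoord M i).
Proof. by move=> a c d; rewrite /dcoord linearP. Qed.

HB.instance Definition _ M i :=
  GRing.isLinear.Build R (dirsum I M) M *:%R (@dcoord M i) (dcoord_is_linear i).

Lemma dirsum_finite M (c : dirsum I M) : finite_set [set i | dcoord i c <> 0].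
Proof. by have /asboolP := valP c. Qed.

Definition dirsum_of M (f : I -> M) (finf : finite_set [set i | f i <> 0]) :
  dirsum I M := Sub f (introT (asboolP _) finf).

Lemma dcoord_dirsum_of M (f : I -> M) finf i : dcoord i (@dirsum_of M f finf) = f i.
Proof. by rewrite /dcoord SubK. Qed.

Lemma dirsum_ext M (c d : dirsum I M) : (forall i, dcoord i c = dcoord i d) -> c = d.
Proof. by move=> cd; apply: val_inj; apply: funext. Qed.

Lemma dirsum_supp M (c : dirsum I M) : exists2 s : seq {classic I},
  uniq s & forall i, i \notin s -> dcoord i c = 0.
Proof.
have /(@finite_seqP {classic I})[s sE] := dirsum_finite c.
exists (undup s) => [|i]; first exact: undup_uniq.
rewrite mem_undup => /negP nis; apply: contrapT => ci.
apply: nis; have : [set i | dcoord i c <> 0] i by [].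
by rewrite sE.
Qed.

(** A coordinate in the free module, with values in the ring rather than in its
    regular module, so that linearity produces products of the ring. *)
Definition fcoord i (c : dirsum I R^o) : R := dcoord i c.
Arguments fcoord : simpl never.

Lemma fcoord_is_scalar i : scalar (@fcoord i).
Proof. by move=> a c d; rewrite /fcoord linearP. Qed.

HB.instance Definition _ i :=
  GRing.isLinear.Build R (dirsum I R^o) R *%R (@fcoord i) (fcoord_is_scalar i).

Lemma free_supp (c : dirsum I R^o) : exists2 s : seq {classic I},
  uniq s & forall i, i \notin s -> fcoord i c = 0.
Proof. exact: (@dirsum_supp R^o c). Qed.

Lemma free_finite (c : dirsum I R^o) : finite_set [set i | fcoord i c <> 0].
Proof. exact: (@dirsum_finite R^o c). Qed.

Definition free_of (f : I -> R) (finf : finite_set [set i | f i <> 0]) :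
  dirsum I R^o := @dirsum_of R^o f finf.

Lemma fcoord_free_of (f : I -> R) finf i : fcoord i (@free_of f finf) = f i.
Proof. exact: (@dcoord_dirsum_of R^o). Qed.

Lemma free_ext (c d : dirsum I R^o) : (forall i, fcoord i c = fcoord i d) -> c = d.
Proof. exact: (@dirsum_ext R^o). Qed.

Lemma delta_finite i : finite_set
  [set j : I | (((i : {classic I}) == j)%:R : R) <> 0].
Proof.
apply: (@sub_finite_set _ _ [set i]) (finite_set1 i) => j /=.
by case: eqP.
Qed.

Definition delta i : dirsum I R^o := free_of (delta_finite i).

Lemma deltaE i j : fcoord j (delta i) = ((i : {classic I}) == j)%:R.
Proof. by rewrite fcoord_free_of. Qed.

(** The linear extension of [u]: the universal property of the free module. *)
Definition flift M (u : I -> M) (c : dirsum I R^o) : M :=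
  \sum_(i \in [set: {classic I}]) fcoord i c *: u i.

Arguments flift : simpl never.

Lemma fliftE M (u : I -> M) (c : dirsum I R^o) (s : seq {classic I}) :
  uniq s -> (forall i, i \notin s -> fcoord i c = 0) ->
  flift u c = \sum_(i <- s) fcoord i c *: u i.
Proof.
move=> us sc; rewrite fsbig_seq// /flift; apply/esym/fsbig_widen => // i [_].
by move=> /negP nis /=; rewrite sc// scale0r.
Qed.

Lemma flift_is_linear M (u : I -> M) : linear (flift u).
Proof.
move=> a c d; have [s us sc] := free_supp c; have [t ut td] := free_supp d.
have h i : i \notin undup (s ++ t) -> fcoord i c = 0 /\ fcoord i d = 0.
  by rewrite mem_undup mem_cat negb_or => /andP[/sc ? /td ?].
rewrite !(@fliftE _ _ _ (undup (s ++ t))) ?undup_uniq//.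
- rewrite scaler_sumr -big_split; apply: eq_bigr => i _ /=.
  by rewrite linearP /= scalerDl scalerA.
- by move=> i /h[].
- by move=> i /h[].
- by move=> i /h[ci di]; rewrite linearP /= ci di mulr0 addr0.
Qed.

HB.instance Definition _ M (u : I -> M) :=
  GRing.isLinear.Build R (dirsum I R^o) M *:%R (flift u) (flift_is_linear u).

Lemma flift_delta M (u : I -> M) i : flift u (delta i) = u i.
Proof.
rewrite (@fliftE _ _ _ [:: i])// => [|j].
  by rewrite big_seq1 deltaE eqxx scale1r.
by rewrite inE deltaE eq_sym => /negPf ->.
Qed.

Lemma dirsum_expand (c : dirsum I R^o) (s : seq {classic I}) :
  uniq s -> (forall i, i \notin s -> fcoord i c = 0) ->
  c = \sum_(i <- s) fcoord i c *: delta i.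
Proof.
move=> us sc; apply: free_ext => j.
rewrite linear_sum.
rewrite (eq_bigr (fun i : {classic I} =>
  (fcoord i c * (i == (j : {classic I}))%:R : R))); last first.
  by move=> i _; rewrite linearZ /= deltaE.
have [js|js] := boolP ((j : {classic I}) \in s); last first.
  rewrite big_seq big1 ?sc// => i si.
  by case: eqP => [ij|]; [rewrite -ij si in js|rewrite mulr0].
rewrite (bigD1_seq (j : {classic I}))//= eqxx mulr1 big1 ?addr0// => i /negPf ->.
by rewrite mulr0.
Qed.

Lemma flift_deltaK (M : lmodType R) (f : {linear dirsum I R^o -> M}) :
  flift (fun i => f (delta i)) =1 f.
Proof.
move=> c; have [s us sc] := free_supp c.
rewrite (fliftE _ us sc) {2}(dirsum_expand us sc) linear_sum.
by apply: eq_bigr => i _; rewrite linearZ.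
Qed.

Lemma flift_comp (M M' : lmodType R) (u : I -> M) (f : {linear M -> M'}) c :
  f (flift u c) = flift (fun i => f (u i)) c.
Proof.
have [s us sc] := free_supp c.
rewrite !(fliftE _ us sc) linear_sum.
by apply: eq_bigr => i _; rewrite linearZ.
Qed.

Lemma flift_submodule M (N : set M) (u : I -> M) c : submodule N ->
  (forall i, N (fcoord i c *: u i)) -> N (flift u c).
Proof.
move=> sN Nu; have [s us sc] := free_supp c.
by rewrite (fliftE _ us sc); apply: submodule_sum.
Qed.

End DirectSum.

(** * Projective modules *)

Section Projective.
Variable R : nzRingType.
Implicit Types A B M P : lmodType R.

(** Maps out of the free module lift by choosing preimages of the basis; the
    retraction transports the lifting. *)
Lemma retract_projective I P (phi : {linear P -> dirsum I R^o})
  (rho : {linear dirsum I R^o -> P}) : cancel phi rho -> projective P.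
Proof.
move=> phiK A B g f gonto.
have /choice[u uE] : forall i : I, exists a, g a = f (rho (delta R i)).
  by move=> i; apply: gonto.
exists (flift u \o phi : {linear P -> A}) => x /=.
rewrite flift_comp; under [X in flift X]eq_fun do rewrite uE.
by rewrite (flift_deltaK (f \o rho)) /= phiK.
Qed.

Lemma projective_split P A (g : {linear A -> P}) : projective P ->
  (forall x, exists a, g a = x) -> exists h : {linear P -> A}, cancel h g.
Proof. by move=> projP gonto; have [h hP] := projP _ _ g idfun gonto; exists h. Qed.

(** The dual basis lemma, obtained by splitting the presentation of P by all of
    its elements. *)
Lemma projective_dual_basis P : projective P ->
  exists (phi : {linear P -> dirsum P R^o}) (u : P -> P), cancel phi (flift u).
Proof.
move=> projP; have [|h hK] := projective_split (g := flift (@id P)) projP.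
  by move=> x; exists (delta R x); rewrite /= flift_delta.
by exists h, id.
Qed.

Lemma free_projective M : free_module M -> projective M.
Proof.
move=> [I [f [g fK gK]]].
have ling : linear g.
  by move=> a x y; rewrite -[x in LHS]gK -[y in LHS]gK -linearP fK.
exact: (@retract_projective I M f (linear_of ling)).
Qed.

End Projective.

(** * The Jacobson radical and Nakayama's lemma *)

Section Radical.
Variable R : nzRingType.
Implicit Types x y r s u : R.

(** The characterization of the Jacobson radical by left invertibility, which
    avoids maximal left ideals. *)
Definition jrad x := forall r, exists u, u * (1 - r * x) = 1.

Lemma jradMl s x : jrad x -> jrad (s * x).
Proof. by move=> radx r; have [u] := radx (r * s); rewrite -mulrA; exists u. Qed.

(** The left inverse u of 1 - x is 1 + u x, which has the same form and hence
    a left inverse of its own; so u is invertible, with inverse 1 - x. *)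
Lemma jrad_inv x : jrad x -> exists v, v * (1 - x) = 1 /\ (1 - x) * v = 1.
Proof.
move=> radx; have [u] := radx 1; rewrite mul1r => ux.
have [w] := radx (- u).
have -> : 1 - - u * x = u by rewrite -ux mulrBr mulr1 mulNr opprK subrK.
move=> wu; exists u; split=> //.
have : w * (u * (1 - x)) = w by rewrite ux mulr1.
by rewrite mulrA wu mul1r => ->.
Qed.

(** If v inverts 1 - s r x, then 1 + r x v s inverts 1 - r x s. *)
Lemma jradMr s x : jrad x -> jrad (x * s).
Proof.
move=> radx r; have [v [vx _]] := jrad_inv (jradMl (s * r) radx).
exists (1 + r * x * v * s).
have e : r * x * v * s - r * x * v * s * (r * x * s) = r * x * s.
  transitivity (r * x * (v * (1 - s * r * x)) * s); last by rewrite vx mulr1.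
  by rewrite mulrBr mulr1 mulrBr mulrBl !mulrA.
by rewrite (mulrA r x s) mulrDl mul1r mulrBr mulr1 e subrK.
Qed.

Lemma jradD x y : jrad x -> jrad y -> jrad (x + y).
Proof.
move=> radx rady r; have [u ux] := radx r; have [w wy] := rady (u * r).
exists (w * u); rewrite (mulrDr r) opprD addrA -mulrA mulrBr ux.
by rewrite (mulrA u) wy.
Qed.

Lemma jrad0 : jrad 0.
Proof. by move=> r; exists 1; rewrite mulr0 subr0 mulr1. Qed.

Lemma jrad_submodule : @submodule R R^o jrad.
Proof.
by split=> [|a x y radx rady]; [exact: jrad0|apply: jradD => //; apply: jradMl].
Qed.

Definition rad_Tnilpotent :=
  forall a : nat -> R, (forall n, jrad (a n)) -> exists n, \prod_(i < n) a i = 0.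

Implicit Types L M : lmodType R.

(** The submodule JM, as the intersection of the submodules that contain all
    products of an element of J and an element of M. *)
Definition radM M (x : M) := forall N : set M, submodule N ->
  (forall j m, jrad j -> N (j *: m)) -> N x.

Lemma radM_submodule M : submodule (@radM M).
Proof.
split=> [N sN _|a x y radx rady N sN jN]; first exact: submodule0.
by case: (sN) => _; apply; [apply: radx|apply: rady].
Qed.

Lemma radM_scale M j (m : M) : jrad j -> radM (j *: m).
Proof. by move=> radj N _; apply. Qed.

Lemma radM_linear L M (f : {linear L -> M}) (x : L) : radM x -> radM (f x).
Proof.
move=> /(_ [set y | radM (f y)]); apply.
  exact/submodule_preim/radM_submodule.
by move=> j m radj /=; rewrite linearZ; apply: radM_scale.
Qed.

Lemma radM_regular (x : R^o) : radM x -> jrad x.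
Proof. by apply; [exact: jrad_submodule|move=> j m; apply: jradMr]. Qed.

Lemma radM_fcoord I (c : dirsum I R^o) i : radM c -> jrad (fcoord i c).
Proof. by move=> /(radM_linear (@dcoord R I R^o i)) /radM_regular. Qed.

Lemma radM_flift I M (u : I -> M) (c : dirsum I R^o) :
  (forall i, jrad (fcoord i c)) -> radM (flift u c).
Proof.
move=> radc; apply: (@flift_submodule R I M (@radM M)) => [|i].
  exact: radM_submodule.
exact: radM_scale.
Qed.

Lemma flift_delta_id I (c : dirsum I R^o) : flift (@delta R I) c = c.
Proof. exact: (flift_deltaK idfun). Qed.

Lemma fcoord_radM I (c : dirsum I R^o) : (forall i, jrad (fcoord i c)) -> radM c.
Proof. by move=> radc; rewrite -(flift_delta_id c); apply: radM_flift. Qed.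

(** If b M is not contained in N, then neither is b a M for some a in J:
    otherwise the elements m with b R m inside N form a submodule that contains
    both N and JM, hence M.  Iterating from b = 1 produces a sequence in J whose
    products never vanish. *)
Lemma nakayama M (N : set M) : rad_Tnilpotent -> submodule N ->
  (forall x : M, exists y : M, N y /\ radM (x - y)) -> forall x : M, N x.
Proof.
move=> Tnil sN Ntop x; apply: contrapT => Nx.
pose T b := exists m, ~ N (b *: m).
have step b : exists a, T b -> jrad a /\ T (b * a).
  apply: contrapT => /forallNP bP.
  have Tb : T b by apply: contrapT => nT; apply: (bP 0).
  have baN a m : jrad a -> N ((b * a) *: m).
    move=> rada; apply: contrapT => nN; apply: (bP a) => _; split=> //.
    by exists m.
  pose N' : set M := [set m | forall r, N (b *: (r *: m))].
  have sN' : submodule N'.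
    split=> [r|r m m' Nm Nm' s] /=; first by rewrite !scaler0; apply: submodule0.
    rewrite scalerDr [s *: (r *: m)]scalerA scalerDr.
    by apply: submoduleD; [|exact: Nm|exact: Nm'].
  case: Tb => m; apply.
  have [y [Ny my]] := Ntop m.
  have N'm : N' (m - y).
    by apply: my => // j m' radj r; rewrite !scalerA; apply/baN/jradMl.
  rewrite -(subrK y m) scalerDr; apply: submoduleD => //.
    by have := N'm 1; rewrite scale1r.
  exact: submoduleZ.
have [f fP] := choice step.
pose b := fix b n := if n is n.+1 then b n * f (b n) else 1 : R.
have Tb n : T (b n).
  by elim: n => [|n /fP[]//]; exists x; rewrite /= scale1r.
have [n] := Tnil (f \o b) (fun n => (fP _ (Tb n)).1).
have -> : \prod_(i < n) (f \o b) i = b n.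
  by elim: n => [|n IHn]; rewrite ?big_ord0// big_ord_recr IHn.
by move=> bn; case: (Tb n) => m; rewrite bn scale0r; apply; apply: submodule0.
Qed.

End Radical.

(** * Descending chains of principal right ideals *)

Section Dcc.
Variable R : nzRingType.
Implicit Types x y r s u w e f g : R.

(** A weak form of the descending chain condition on principal right ideals:
    a chain is only required to contain two equal successive terms. *)
Definition dcc_principal_right := forall x r : nat -> R,
  (forall n, x n.+1 = x n * r n) -> exists n s, x n = x n.+1 * s.

Definition nilpotent x := exists n, x ^+ n = 0.

(** Idempotents lift modulo nilpotent elements.  With g = 1 - (1 - w)^k, which is
    a multiple of w, the idempotent is g^k: it is a multiple of w^k and
    1 - g^k is a multiple of (1 - w)^k.  The second conclusion prevents the
    idempotent from being zero. *)
Lemma lift_idempotent w k : (w ^+ 2 - w) ^+ k = 0 ->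
  exists h, (w * h) * (w * h) = w * h /\ forall y, y * w = y -> y * (w * h) = y.
Proof.
case: k => [/eqP|k]; first by rewrite expr0 oner_eq0.
move=> wk.
have cw : GRing.comm w (1 - w) by apply: commrB => //; exact: commr1.
have wv0 : w ^+ k.+1 * (1 - w) ^+ k.+1 = 0.
  rewrite -exprMn_comm// mulrBr mulr1 -expr2 -opprB exprNn wk.
  by rewrite mulr0.
pose h0 := \sum_(i < k.+1) (1 - w) ^+ i.
pose g := 1 - (1 - w) ^+ k.+1.
have gE : g = w * h0.
  rewrite /g -opprB subrX1 -mulNr; congr (_ * _).
  by rewrite addrAC subrr sub0r opprK.
have ch : GRing.comm w h0 by apply: commr_sum => i _; exact: commrX.
have gk : g ^+ k.+1 = h0 ^+ k.+1 * w ^+ k.+1.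
  by rewrite gE ch exprMn_comm//; exact: commr_sym.
exists (h0 * g ^+ k); rewrite (mulrA w h0) -gE -exprS; split; last first.
  move=> y yw; have yv i : y * (1 - w) ^+ i.+1 = 0.
    by rewrite exprS mulrA mulrBr yw mulr1 subrr mul0r.
  have yg : y * g = y by rewrite mulrBr mulr1 yv subr0.
  have ygi i : y * g ^+ i = y.
    by elim: i => [|i IHi]; rewrite ?mulr1// exprS mulrA yg.
  exact: ygi.
apply/eqP; rewrite -subr_eq0 -[X in _ - X]mulr1 -mulrBr.
rewrite -[g ^+ k.+1 - 1]opprK opprB -[1 - _]opprB subrX1.
have -> : g - 1 = - (1 - w) ^+ k.+1 by rewrite /g addrAC subrr sub0r.
by rewrite opprK mulNr mulrN {1}gk mulrA -(mulrA _ _ (_ ^+ _)) wv0 mulr0 mul0r oppr0.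
Qed.

Hypothesis dccR : dcc_principal_right.

(** A nonempty family of principal right ideals has a minimal member; the family
    is given by the set of the generators considered.  Otherwise dependent choice
    builds a chain without two equal successive terms. *)
Lemma dcc_minimal (S : set R) x0 : S x0 ->
  exists x, S x /\ forall r, S (x * r) -> exists s, x = x * r * s.
Proof.
move=> Sx0; apply: contrapT => nS.
have step x : exists r, S x -> S (x * r) /\ forall s, x <> x * r * s.
  apply: contrapT => /forallNP xP; apply: nS; exists x.
  have Sx : S x by apply: contrapT => nSx; apply: (xP 0).
  split=> // r Sxr; apply: contrapT => /forallNP xrs.
  by apply: (xP r).
have [f fP] := choice step.
pose x := fix x n := if n is n.+1 then x n * f (x n) else x0.
have Sx n : S (x n) by elim: n => //= n /fP[].
have [n [s]] := dccR (fun n => erefl (x n.+1)).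
by have [_] := fP _ (Sx n); apply.
Qed.

(** If b = b a s with a in J, then b (1 - a s) = 0 and 1 - a s is invertible. *)
Lemma dcc_Tnilpotent : rad_Tnilpotent R.
Proof.
move=> a rada; pose b n := \prod_(i < n) a i.
have [n [s]] : exists n s, b n = b n.+1 * s.
  by apply: (dccR (r := a)) => n; rewrite /b big_ord_recr.
rewrite /b big_ord_recr /= -/(b n) -mulrA => bn; exists n.
have [v [_ av]] := jrad_inv (jradMr s (rada n)).
by rewrite -/(b n) -[b n]mulr1 -av mulrA mulrBr mulr1 -bn subrr mul0r.
Qed.

(** Let y be a non-nilpotent element of xR that generates a minimal ideal among
    such elements.  Then y = y y z, so w = y z is a right unit for y, and w is
    idempotent up to a nilpotent error: were w^2 - w not nilpotent, it would
    generate yR, but it is annihilated by y on the left. *)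
Lemma nonnil_idempotent x : ~ nilpotent x ->
  exists r, [/\ (x * r) * (x * r) = x * r & x * r <> 0].
Proof.
move=> nx.
pose S : set R := [set y | (exists r, y = x * r) /\ ~ nilpotent y].
have nn0 : nilpotent 0 by exists 1; rewrite expr1.
have [|y [[[r yE] ny] ymin]] := @dcc_minimal S x.
  by split=> //; exists 1; rewrite mulr1.
have [z yz] : exists z, y = y * y * z.
  apply: ymin; split; first by exists (r * y); rewrite mulrA -yE.
  by move=> [n yn]; apply: ny; exists (2 * n)%N; rewrite exprM expr2.
pose w := y * z.
have yw : y * w = y by rewrite /w mulrA -yz.
have [k wk] : nilpotent (w ^+ 2 - w).
  apply: contrapT => nw.
  have wE : w ^+ 2 - w = y * (z * w - z).
    by rewrite mulrBr mulrA -/w expr2.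
  have [|s ys] := ymin (z * w - z).
    split; rewrite -?wE //.
    by exists (r * (z * w - z)); rewrite mulrA -yE.
  apply: ny; exists 2; rewrite expr2 {2}ys -wE mulrA mulrBr expr2 mulrA yw yw.
  by rewrite subrr mul0r.
have [h [he hy]] := lift_idempotent wk.
exists (r * z * h); have -> : x * (r * z * h) = w * h by rewrite !mulrA -yE.
split=> //.
move=> wh; apply: ny; exists 1%N.
by rewrite expr1 -(hy y yw) wh mulr0.
Qed.

Definition primitive e := [/\ e * e = e, e <> 0 &
  forall g, g * g = g -> e * g = g -> g * e = g -> g = 0 \/ g = e].

(** Non-nilpotent elements of e R e are left invertible there, so this ring is
    local: the idempotent f found in xR gives the idempotent f e of e R e, which
    can only be e. *)
Lemma primitive_inv e x : primitive e -> e * x = x -> x * e = x ->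
  ~ nilpotent x -> exists s, s * x = e.
Proof.
move=> [ee e0 emin] ex xe nx.
have [r []] := nonnil_idempotent nx; set f := x * r => ff f0.
have ef : e * f = f by rewrite mulrA ex.
have fe : f * e = e.
  have fefe : f * e * (f * e) = f * e by rewrite mulrA -(mulrA f) ef ff.
  have [||fe0|//] := emin (f * e) fefe; first by rewrite mulrA ef.
    by rewrite -mulrA ee.
  by case: f0; rewrite -ff -[in X in _ * X]ef mulrA fe0 mul0r.
pose y := e * r * e.
have xy : x * y = e by rewrite /y !mulrA xe -/f fe.
have ey : e * y = y by rewrite /y !mulrA ee.
have ye : y * e = y by rewrite /y -!mulrA ee.
have xyx : x * (y * x) = x by rewrite mulrA xy.
exists y.
have [] := emin (y * x) => //.
- by rewrite mulrA -(mulrA y) xy ye.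
- by rewrite mulrA ey.
- by rewrite -mulrA xe.
move=> yx0; case: e0; move: xyx; rewrite yx0 mulr0 => x0.
by rewrite -xy -x0 mul0r.
Qed.

(** R e has J e as its only maximal submodule. *)
Lemma primitive_jrad e r : primitive e -> ~ jrad (r * e) ->
  exists s, s * (r * e) = e.
Proof.
move=> prim nrad; case: (prim) => ee _ _.
have [t tP] : exists t, ~ exists u, u * (1 - t * (r * e)) = 1.
  by apply: contrapT => /forallNP tP; apply: nrad => t; apply: contrapT; apply: tP.
pose x := e * t * r * e.
have [s sx] : exists s, s * x = e.
  apply: primitive_inv => //; rewrite /x ?mulrA ?ee -?mulrA ?ee//.
  move=> [n]; rewrite !mulrA -/x => xn; apply: tP.
  have tre m : (t * (r * e)) ^+ m.+1 = t * r * x ^+ m * e.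
    elim: m => [|m IHm]; first by rewrite expr1 expr0 mulr1 mulrA.
    by rewrite exprSr IHm [x ^+ m.+1]exprSr /x -!mulrA ee.
  have := subrX1 (t * (r * e)) n.+1; rewrite tre xn mulr0 mul0r sub0r => h.
  exists (\sum_(i < n.+1) (t * (r * e)) ^+ i).
  have c : GRing.comm (1 - t * (r * e)) (\sum_(i < n.+1) (t * (r * e)) ^+ i).
    apply: commr_sum => i _; apply: commrX; apply: commr_sym.
    by apply: commrB => //; exact: commr1.
  by rewrite -c -opprB mulNr -h opprK.
by exists (s * e * t); rewrite -[RHS]sx /x !mulrA.
Qed.

(** An idempotent f with f m outside N, minimal for fR, is primitive: if f is a
    sum of two orthogonal idempotents, one of the two also moves m out of N. *)
Lemma exists_primitive (M : lmodType R) (N : set M) m : submodule N -> ~ N m ->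
  exists2 e, primitive e & ~ N (e *: m).
Proof.
move=> sN Nm; pose S : set R := [set f | f * f = f /\ ~ N (f *: m)].
have [|f [[ff Nfm] fmin]] := @dcc_minimal S 1.
  by split; rewrite ?mulr1 ?scale1r.
exists f => //; split=> //.
  by move=> f0; apply: Nfm; rewrite f0 scale0r; apply: submodule0.
have part g : g * g = g -> f * g = g -> g * f = g -> ~ N (g *: m) -> g = f.
  move=> gg fg gf Ngm; have [|s] := fmin g; rewrite fg; first by [].
  by move=> fE; rewrite -gf {1}fE mulrA gg.
move=> g gg fg gf; have [Ngm|] := pselect (N (g *: m)); last by right; apply: part.
left; have : f - g = f.
  apply: part; rewrite ?mulrBr ?mulrBl ?ff ?fg ?gf ?gg ?subrr ?subr0//.
  by rewrite scalerBl => Nfgm; apply: Nfm; rewrite -(subrK (g *: m) (f *: m));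
    apply: submoduleD.
by move/(congr1 (fun x => f - x)); rewrite subKr subrr.
Qed.

End Dcc.

(** * Bases modulo the radical and projective covers *)

(** Here N contains JM, so that M/N is a module over the semisimple ring R/J.  The
    section constructs the analogue of a basis of M/N, made of elements of
    the form e m with e primitive, while only speaking of M. *)
Section TopBasis.
Variables (R : nzRingType) (M : lmodType R) (N : set M).
Hypotheses (dccR : dcc_principal_right R) (sN : submodule N).
Hypothesis (jN : forall j m, jrad j -> N (j *: m)).

(** A triple (c, (e, m)) of the list stands for the term c e m of a linear
    combination. *)
Definition independent (S : set (R * M)) := forall s : seq (R * (R * M)),
  uniq (map snd s) -> (forall q, q \in s -> S q.2) ->
  N (\sum_(q <- s) q.1 *: (q.2.1 *: q.2.2)) ->
  forall q, q \in s -> jrad (q.1 * q.2.1).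

Lemma independent_bigcup (F : set (set (R * M))) : total_on F subset ->
  (forall X, F X -> independent X) -> independent (\bigcup_(X in F) X).
Proof.
move=> totF indF s us sF Ns q qs.
suff [X FX sX] : exists2 X, F X & forall q, q \in s -> X q.2.
  exact: indF _ FX s us sX Ns q qs.
have {qs us Ns} : s != [::] by case: s qs {us sF Ns}.
elim: s sF => // q0 s IHs sF _.
have [X0 FX0 X0q] := sF q0 (mem_head _ _).
case: s => [|q1 s] in IHs sF *.
  by exists X0 => // q'; rewrite inE => /eqP ->.
have [||X FX sX] := IHs => //.
  by move=> q' q's; apply: sF; rewrite inE q's orbT.
have [XX0|X0X] := totF _ _ FX FX0.
  by exists X0 => // q'; rewrite inE => /predU1P[->//|/sX /XX0].
by exists X => // q'; rewrite inE => /predU1P[->|/sX//]; apply: X0X.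
Qed.

(** In a relation with coefficient c on e m, either c e is in the radical and the
    term can be dropped, or e is a multiple of c e, and then e m would belong to
    the submodule L that contains N and the other terms. *)
Lemma independent_setU1 (S : set (R * M)) (L : set M) (e : R) m :
  independent S -> submodule L -> N `<=` L ->
  (forall p, S p -> L (p.1 *: p.2)) -> primitive e -> ~ L (e *: m) ->
  independent (S `|` [set (e, m)]).
Proof.
move=> indS sL NL SL prime Lem s us sS Ns.
have [/mapP[q0 q0s q0E]|nps] := boolP ((e, m) \in map snd s); last first.
  apply: indS => // q qs; have [//|/= qE] := sS q qs.
  by case/negP: nps; rewrite -qE map_f.
have ps := perm_to_rem q0s.
have us' : uniq (map snd (q0 :: rem q0 s)) by rewrite -(perm_uniq (perm_map snd ps)).
rewrite (perm_big _ ps) big_cons /= -q0E /= in Ns.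
have sS' q : q \in rem q0 s -> S q.2.
  move=> qs; have [//|/= qE] := sS q (mem_rem qs).
  move: us'; rewrite /= => /andP[/negP nq0 _].
  by case: nq0; rewrite -q0E -qE map_f.
have us'' : uniq (map snd (rem q0 s)) by case/andP: us'.
have rade : jrad (q0.1 * e).
  apply: contrapT => /(primitive_jrad dccR prime)[t te]; apply: Lem.
  rewrite -te -scalerA; apply: submoduleZ => //; rewrite -scalerA.
  set S0 := \sum_(_ <- _) _ in Ns.
  rewrite -[_ *: _](addrK S0); apply: submoduleB => //; first exact: NL.
  apply: submodule_sum => // q /sS' Sq; apply: submoduleZ => //.
  exact: SL.
move=> q; rewrite (perm_mem ps) inE => /predU1P[->|]; first by rewrite -q0E.
apply: (indS _ us'' sS'); set S0 := \sum_(_ <- _) _ in Ns *.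
rewrite -[S0](addKr (q0.1 *: (e *: m))) addrC; apply: submoduleB => //.
by rewrite scalerA; apply: jN.
Qed.

(** Maximality gives the last clause, because a vector outside L could be cut by
    a primitive idempotent so as to enlarge the family. *)
Lemma maximal_independent : exists S : set (R * M),
  [/\ forall p, S p -> primitive p.1, independent S &
      forall L : set M, submodule L -> N `<=` L ->
        (forall p, S p -> L (p.1 *: p.2)) -> forall x, L x].
Proof.
pose P (S : set (R * M)) := (forall p, S p -> primitive p.1) /\ independent S.
have [F FP totF|S [[Sprim indS] Smax]] := @Zorn_bigcup _ P.
  split=> [p [X /FP[Xprim _]]|]; first exact: Xprim.
  by apply: independent_bigcup => // X /FP[].
exists S; split=> // L sL NL SL x; apply: contrapT => nLx.
have [e prime Lex] := exists_primitive dccR sL nLx.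
apply: (Smax (S `|` [set (e, x)])).
  split=> [p Sp|]; first by left.
  by move=> /(_ (e, x) (or_intror erefl)) /SL.
split; last exact: (independent_setU1 indS sL).
by move=> p [/Sprim//|->].
Qed.

(** The maximal family is indexed by itself, so that its combinations are
    parametrized by a free module. *)
Lemma top_basis : exists (I : Type) (e : I -> R) (u : I -> M),
  [/\ forall i, e i * e i = e i, forall i, e i *: u i = u i,
      forall c, N (flift u c) -> forall i, jrad (fcoord i c * e i) &
      forall x, exists c, N (x - flift u c)].
Proof.
have [S [Sprim indS Smax]] := maximal_independent.
pose I := {p | S p}; pose e (i : I) := (sval i).1.
pose u (i : I) := e i *: (sval i).2.
have ee i : e i * e i = e i by case: i => [p Sp]; have [] := Sprim p Sp.
exists I, e, u; split=> //.
- by move=> i; rewrite /u scalerA ee.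
- move=> c Nc i; have [s us sc] := free_supp c.
  have [si|/sc ->] := boolP ((i : {classic I}) \in s); last first.
    by rewrite mul0r; apply: jrad0.
  have sval_inj : injective (sval : {classic I} -> R * M).
    by move=> [p Sp] [q Sq] /= pq; apply: eq_exist.
  have mem : (fcoord i c, sval i) \in [seq (fcoord j c, sval j) | j : {classic I} <- s].
    exact: (map_f (fun j : {classic I} => (fcoord j c, sval j)) si).
  apply: (indS _ _ _ _ _ mem).
  + by rewrite -map_comp (map_inj_uniq sval_inj).
  + by move=> q /mapP[[p Sp] _ ->].
  + by rewrite big_map; rewrite (fliftE u us sc) in Nc.
- move=> x; apply: (Smax [set x | exists c, N (x - flift u c)]).
  + split=> [|a y z [c Nc] [d Nd]].
      by exists 0; rewrite (linear0 (flift u)) subr0; apply: submodule0.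
    exists (a *: c + d); rewrite (linearP (flift u)) opprD addrACA -scalerBr.
    by case: (sN) => _; apply.
  + by move=> y Ny; exists 0; rewrite (linear0 (flift u)) subr0.
  + move=> p Sp; exists (delta R (exist _ p Sp)).
    by rewrite flift_delta subrr; apply: submodule0.
Qed.

End TopBasis.

Section Perfect.
Variable R : nzRingType.
Implicit Types M P : lmodType R.

Lemma superfluous_radM P (K : set P) : rad_Tnilpotent R ->
  K `<=` @radM R P -> superfluous K.
Proof.
move=> Tnil KP N [N0 Nlin] NK x.
apply: (@nakayama R P [set y | y \in N]) => // y.
have [u [v [uN Kv ->]]] := NK y; exists u; split=> //.
by rewrite addrAC subrr add0r; apply: KP.
Qed.

(** The cover is the direct sum of the modules R e_i, realized inside the free
    module as the fixed vectors of the projection [rho] that multiplies the i-th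
    coordinate by e_i on the right. *)
Lemma dcc_left_perfect : dcc_principal_right R -> left_perfect R.
Proof.
move=> dccR M; have Tnil := dcc_Tnilpotent dccR.
have [I [e [u [ee eu ind spn]]]] :=
  top_basis dccR (@radM_submodule R M) (@radM_scale R M).
pose rho := flift (fun i => e i *: delta R i).
have fcoord_rho i c : fcoord i (rho c) = fcoord i c * e i.
  rewrite -[c in RHS]flift_delta_id /rho.
  have [s us sc] := free_supp c; rewrite !(fliftE _ us sc) !linear_sum.
  rewrite mulr_suml; apply: eq_bigr => j _; rewrite !linearZ /= deltaE -mulrA.
  by case: eqP => [->|]; rewrite ?mulr0 ?mul0r ?mulr0// mulr1 mul1r.
have rhoK c : rho (rho c) = rho c.
  by apply: free_ext => i; rewrite !fcoord_rho -mulrA ee.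
pose F : {linear dirsum I R^o -> dirsum I R^o} := idfun \- rho.
have FE c : F c = c - rho c by [].
have [pi piE] : exists pi : {linear dirsum I R^o -> kernel_mod F},
    forall c, kernel_val (pi c) = rho c.
  by apply: kernel_mod_corestrict => c; rewrite FE rhoK subrr.
pose iota := @kernel_val R _ _ F.
have piK : cancel iota pi.
  move=> x; apply: kernel_val_inj; rewrite piE; apply/esym/eqP; rewrite -subr_eq0 -FE.
  by rewrite kernel_valP.
have flift_rho c : flift u (rho c) = flift u c.
  rewrite flift_comp; congr (flift _ c : M); apply: funext => i.
  by rewrite linearZ /= flift_delta eu.
exists (kernel_mod F), (flift u \o iota); split.
- exact: retract_projective piK.
- move=> x; pose im := range (flift u).
  have [|c _ <-] := nakayama (N := im) Tnil (submodule_range _) _ x.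
    by move=> y; have [c cy] := spn y; exists (flift u c); split=> //; exists c.
  by exists (pi c); rewrite /= piE flift_rho.
- apply: superfluous_radM => // x /= x0; rewrite -(piK x).
  apply: (radM_linear pi); apply: fcoord_radM => i.
  have -> : iota x = rho (iota x) by rewrite -piE piK.
  by rewrite fcoord_rho; apply: ind; rewrite x0; apply: submodule0 (radM_submodule _).
Qed.

End Perfect.

(** * Descending chains under projectivity of the countable power *)

(** Cantor's diagonal argument. *)
Lemma cantor_collision (h : (nat -> bool) -> nat) :
  exists a b, a <> b /\ h a = h b.
Proof.
apply: contrapT => nh; have hinj a b : h a = h b -> a = b.
  by move=> hab; apply: contrapT => ab; apply: nh; exists a, b.
pose D n := `[< exists a, h a = n /\ a n = false >].
have /asboolP[a [/hinj -> DhD]] : D (h D).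
  apply: contrapT => nD; apply: (nD); apply/asboolP; exists D; split=> //.
  exact/negP.
by move: (DhD) => /asboolP; apply; exists D.
Qed.

Section Chase.
Variable R : nzRingType.

Definition entry (t : nat) (y : Romega R) : R := y t.
Arguments entry : simpl never.

Lemma entry_is_scalar t : scalar (@entry t).
Proof. by []. Qed.

HB.instance Definition _ t :=
  GRing.isLinear.Build R (Romega R) R *%R (@entry t) (entry_is_scalar t).

Lemma Romega_ext (y z : Romega R) : (forall t, entry t y = entry t z) -> y = z.
Proof. by move=> yz; apply: funext. Qed.

Section DualBasis.
Variables (X : Type) (phi : {linear Romega R -> dirsum X R^o}).
Variables (u : X -> Romega R) (phiK : cancel phi (flift u)).
Variables (x r : nat -> R) (xr : forall n, x n.+1 = x n * r n).

Let tail n (y : Romega R) := forall t, (t < n)%N -> entry t y = 0.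

Lemma chain_multiple n i : (n <= i)%N -> exists q, x i = x n * q.
Proof.
move=> /subnK <-; elim: (i - n)%N => [|k [q kE]]; first by exists 1; rewrite mulr1.
by exists (q * r (k + n)%N); rewrite addSn xr kE mulrA.
Qed.

(** Gliding hump.  If the conclusion fails at every n, choose y_n supported
    beyond n and a coordinate s_n of x_n y_n outside x_(n+1) R which vanishes on
    all previous x_i y_i.  The sum z of the x_n y_n makes sense pointwise, and its
    s_n-th coordinate is the sum of a term outside x_(n+1) R and of a
    coordinate of the tail, which is in x_(n+1) R.  So z has infinitely many
    nonzero coordinates. *)
Lemma uniform_coords : exists n (S : set X), finite_set S /\
  forall y, tail n y -> forall s, ~ S s ->
    exists v, fcoord s (phi (x n *: y)) = x n.+1 * v.
Proof.
apply: contrapT => nS.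
have [s0 _] : exists s0 : X, True.
  apply: contrapT => nX; apply: nS; exists 0, set0; split=> // y _ s.
  by case: nX; exists s.
have step (p : nat * set X) : exists q : Romega R * X, finite_set p.2 ->
    [/\ tail p.1 q.1, ~ p.2 q.2 &
      forall v, fcoord q.2 (phi (x p.1 *: q.1)) <> x p.1.+1 * v].
  case: p => n S /=; apply: contrapT => /forallNP nq.
  have finS : finite_set S by apply: contrapT => nf; apply: (nq (0, s0)).
  apply: nS; exists n, S; split=> // y ty s Ss; apply: contrapT => nv.
  by apply: (nq (y, s)) => _; split=> // v e; apply: nv; exists v.
have [f fP] := choice step.
pose S := fix S n := if n is n'.+1 then
  S n' `|` [set s | fcoord s (phi (x n' *: (f (n', S n')).1)) <> 0] else set0.
pose y n := (f (n, S n)).1; pose s n := (f (n, S n)).2.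
have finS n : finite_set (S n).
  by elim: n => [|n IHn] //=; rewrite finite_setU; split=> //; apply: free_finite.
have [ty Ss nv] : [/\ forall n, tail n (y n), forall n, ~ S n (s n) &
    forall n v, fcoord (s n) (phi (x n *: y n)) <> x n.+1 * v].
  by split=> n; have [] := fP (n, S n) (finS n).
have S_step n : S n `<=` S n.+1 by left.
have S_new n t : fcoord t (phi (x n *: y n)) <> 0 -> S n.+1 t by right.
clearbody y s; clearbody S => {f fP step nS}.
have S_mono m n : (m <= n)%N -> S m `<=` S n.
  by move=> /subnK <-; elim: (n - m)%N => // k IHk t /IHk; apply: S_step.
(* At index t only the y_i with i <= t contribute. *)
pose z : Romega R := fun t => \sum_(i < t.+1) x i * entry t (y i).
have zE n : exists v : Romega R, z = \sum_(i < n) x i *: y i + x n *: v.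
  have /choice[v vP] : forall t, exists w,
      entry t z - \sum_(i < n) x i * entry t (y i) = x n * w.
    move=> t; rewrite /entry /z -/(entry _ _).
    rewrite -!(big_mkord xpredT (fun i => x i * entry t (y i))).
    have [nt|tn] := leqP n t.+1.
      rewrite (big_cat_nat _ nt)//= addrAC subrr add0r big_nat.
      elim/big_ind: _ => [|_ _ [a ->] [b ->]|i /andP[ni _]].
      - by exists 0; rewrite mulr0.
      - by exists (a + b); rewrite mulrDr.
      - have [q ->] := chain_multiple ni.
        by exists (q * entry t (y i)); rewrite mulrA.
    exists 0; rewrite (big_cat_nat _ (ltnW tn))//= opprD addrA subrr add0r mulr0.
    rewrite big_nat big1 ?oppr0// => i /andP[ti _].
    by rewrite ty ?mulr0.
  exists v; apply: Romega_ext => t; rewrite linearD linear_sum linearZ /=.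
  rewrite -[x n * _]vP addrC -(eq_bigr _ (fun i _ => linearZ _ _)) subrK//.
have sz n : fcoord (s n) (phi z) <> 0.
  have [v ->] := zE n.+1; rewrite big_ord_recr /= !linearD /= linear_sum.
  rewrite linear_sum big1 => [|i _]; last first.
    apply: contrapT => ne; apply: (Ss n).
    by apply: (S_mono i.+1) => //; apply: S_new.
  rewrite add0r [phi (x n.+1 *: v)]linearZ [fcoord _ (_ *: phi v)]linearZ /=.
  move=> /eqP; rewrite addr_eq0 => /eqP.
  by rewrite -mulrN; apply: nv.
have s_neq m n : (m < n)%N -> s m <> s n.
  move=> mn smn; apply: (Ss n); rewrite -smn; apply: (S_mono m.+1) => //; apply: S_new.
  by move=> e; apply: (nv m 0); rewrite mulr0.
have sinj : injective s.
  by move=> m n smn; case: (ltngtP m n) => // /s_neq; rewrite smn.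
apply: infinite_nat.
apply: (@sub_finite_set _ _ (s @^-1` [set t | fcoord t (phi z) <> 0])).
  by move=> n _; apply: sz.
apply: finite_preimage (free_finite _).
by move=> m n _ _; apply: sinj.
Qed.

(** Two 0/1 vectors supported beyond n share the coordinates in the
    exceptional finite set S.  Their difference y has all coordinates of x_n y in
    x_(n+1) R, so x_n y is a multiple of x_(n+1); at an index where the two
    vectors differ, y is 1 or -1. *)
Lemma chain_stops : countable [set: R] -> exists n s, x n = x n.+1 * s.
Proof.
move=> /countable_injP[c cinj].
have {}cinj : injective c by move=> a b; apply: cinj; rewrite in_setT.
have [n [S [/(@finite_seqP {classic X})[ss SE] nS]]] := uniform_coords.
pose chi (a : nat -> bool) : Romega R :=
  fun t => if (t < n)%N then 0 else (a (t - n)%N)%:R.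
have [a [b [ab]]] := cantor_collision (fun a =>
  pickle [seq c (fcoord s (phi (x n *: chi a))) | s : {classic X} <- ss]).
move=> /(pcan_inj pickleK) /eq_in_map cE.
have coordE s : S s -> fcoord s (phi (x n *: (chi a - chi b))) = 0.
  rewrite scalerBr !linearB /= => Ss; apply/eqP; rewrite subr_eq0; apply/eqP.
  by apply: cinj; apply: (cE s); move: Ss; rewrite SE.
have [k abk] : exists k, a k <> b k.
  by apply: contrapT => /forallNP abE; apply: ab; apply: funext => k; apply: contrapT.
have /choice[v vP] : forall s, exists v,
    fcoord s (phi (x n *: (chi a - chi b))) = x n.+1 * v /\
    (fcoord s (phi (x n *: (chi a - chi b))) = 0 -> v = 0).
  move=> s; have [s0|s0] := pselect (fcoord s (phi (x n *: (chi a - chi b))) = 0).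
    by exists 0; rewrite mulr0.
  have [||v vE] := nS (chi a - chi b) _ s.
  - by move=> t tn; rewrite linearB /= /entry /chi tn subrr.
  - by move/coordE.
  - by exists v.
have finv : finite_set [set s | v s <> 0].
  apply: sub_finite_set (free_finite (phi (x n *: (chi a - chi b)))) => s vs cs.
  by apply: vs; apply: (vP s).2.
have := phiK (x n *: (chi a - chi b)).
have -> : phi (x n *: (chi a - chi b)) = x n.+1 *: free_of finv.
  by apply: free_ext => s; rewrite (vP s).1 linearZ /= fcoord_free_of.
rewrite linearZ => /(congr1 (entry (k + n))); rewrite !linearZ linearB /=.
set w := entry _ (flift _ _); rewrite /entry /chi ltnNge leq_addl /= addnK.
case: (a k) (b k) abk => -[]//= _.
  by rewrite subr0 mulr1 => e; exists n, w.
by rewrite sub0r mulrN1 => /eqP; rewrite -eqr_oppLR -mulrN => /eqP e; exists n, (- w).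
Qed.

End DualBasis.

Lemma P_ring_dcc : countable [set: R] -> P_ring R -> dcc_principal_right R.
Proof.
move=> ctR /projective_dual_basis[phi [u phiK]] x r xr.
exact: (chain_stops phiK xr).
Qed.

End Chase.

(** * Coherence under projectivity of the countable power *)

Section Lincomb.
Variable S : nzRingType.
Implicit Types M : lmodType S.

Lemma lincomb_is_linear M n (g : 'I_n -> M) : linear (lincomb g).
Proof.
move=> a c d; rewrite /lincomb scaler_sumr -big_split; apply: eq_bigr => i _.
by rewrite !mxE scalerDl scalerA.
Qed.

HB.instance Definition _ M n (g : 'I_n -> M) :=
  GRing.isLinear.Build S 'rV[S]_n M *:%R (lincomb g) (lincomb_is_linear g).

Lemma linear_lincomb M M' n (g : 'I_n -> M) (f : {linear M -> M'}) c :
  f (lincomb g c) = lincomb (f \o g) c.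
Proof. by rewrite linear_sum; apply: eq_bigr => i _; rewrite linearZ. Qed.

Lemma lincomb_delta M n (g : 'I_n -> M) i : lincomb g (delta_mx 0 i) = g i.
Proof.
rewrite /lincomb (bigD1 i)//= mxE !eqxx scale1r big1 ?addr0// => j /negPf ji.
by rewrite mxE ji andbF scale0r.
Qed.

Lemma lincomb_deltas n (c : 'rV[S]_n) : lincomb (fun i => delta_mx 0 i) c = c.
Proof. by rewrite [RHS]row_sum_delta. Qed.

Lemma range_lincomb M n (g : 'I_n -> M) i : range (lincomb g) (g i).
Proof. by exists (delta_mx 0 i) => //; rewrite lincomb_delta. Qed.

Definition relations M n (g : 'I_n -> M) : set 'rV[S]_n :=
  [set c | lincomb g c = 0].

(** Let B express the a_i through the g_j, and C conversely.  A relation c of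
    a is (c - C B c) + C (B c), where the first term is a combination of the
    relations e_i - C B e_i and B c is a relation of g. *)
Lemma relations_fg_indep M n k (g : 'I_n -> M) (a : 'I_k -> M) :
  range (lincomb g) = range (lincomb a) ->
  finitely_generated (relations g) -> finitely_generated (relations a).
Proof.
move=> ga [m [d dE]].
have /choice[B BP] i : exists b, lincomb g b = a i.
  by have := range_lincomb a i; rewrite -ga => -[b _]; exists b.
have /choice[C CP] i : exists b, lincomb a b = g i.
  by have := range_lincomb g i; rewrite ga => -[b _]; exists b.
have aC b : lincomb a (lincomb C b) = lincomb g b.
  by rewrite linear_lincomb; apply: eq_bigr => i _ /=; rewrite CP.
have gB b : lincomb g (lincomb B b) = lincomb a b.
  by rewrite linear_lincomb; apply: eq_bigr => i _ /=; rewrite BP.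
pose h1 i : 'rV_k := delta_mx 0 i - lincomb C (B i).
pose h2 j := lincomb C (d j).
pose h i := match fintype.split i with inl i1 => h1 i1 | inr i2 => h2 i2 end.
exists (k + m)%N, h; apply/seteqP; split=> [c c0|_ [c _ <-]]; rewrite /relations /=.
  have : relations g (lincomb B c) by rewrite /relations /= gB.
  rewrite dE => -[l _ lE]; exists (row_mx c l) => //.
  rewrite /lincomb big_split_ord /=.
  under eq_bigr do rewrite row_mxEl /h (unsplitK (inl _)) scalerBr.
  under [X in _ + X]eq_bigr do rewrite row_mxEr /h (unsplitK (inr _)).
  rewrite sumrB -[X in X - _]/(lincomb _ c) lincomb_deltas.
  rewrite -[X in _ - X]/(lincomb (lincomb C \o B) c) -linear_lincomb.
  by rewrite -[X in _ + X]/(lincomb (lincomb C \o d) l) -linear_lincomb lE subrK.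
rewrite linear_sum big1// => i _; rewrite linearZ /= /h.
case: fintype.split => j; rewrite /h1 /h2 ?linearB /= aC.
  by rewrite lincomb_delta BP subrr scaler0.
have : relations g (d j) by rewrite dE; apply: range_lincomb.
by rewrite /relations /= => ->; rewrite scaler0.
Qed.

End Lincomb.

Lemma right_coherent_relations (R : nzRingType) n (a : 'I_n -> (R^c)^o) :
  right_coherent R -> finitely_generated (relations a).
Proof.
move=> coh; have [|k [g [ag gfg]]] := coh (range (lincomb a)).
  by exists n, a.
exact: relations_fg_indep (esym ag) gfg.
Qed.

Lemma countable_enum_rV (R : Type) n (K : set 'rV[R]_n) k0 :
  countable [set: R] -> K k0 -> exists e : nat -> 'rV[R]_n, K = range e.
Proof.
move=> /countable_injP[c cinj] Kk0.
have {}cinj : injective c by move=> a b; apply: cinj; rewrite in_setT.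
pose code (k : 'rV[R]_n) : nat := pickle [ffun i => c (k 0 i)].
have code_inj : injective code.
  move=> k l /(pcan_inj pickleK) /ffunP kl; apply/rowP => i; apply: cinj.
  by have := kl i; rewrite !ffunE.
have /choice[e eP] t : exists k, K k /\ forall l, K l -> code l = t -> k = l.
  have [[k [Kk kt]]|nk] := pselect (exists k, K k /\ code k = t).
    by exists k; split=> // l _ lt; apply: code_inj; rewrite kt.
  by exists k0; split=> // l Kl lt; case: nk; exists l.
exists e; apply/seteqP; split=> [k Kk|_ [t _ <-]]; last by have [] := eP t.
by exists (code k) => //; have [_] := eP (code k); apply.
Qed.

(** The relations of g, listed as e 0, e 1, ..., are the values at each index t
    of the vectors x_i.  Taking coordinates in the relation between the x_i gives
    finitely many relations d_j, and evaluating the expansion of the x_i at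
    t writes e t as a combination of the d_j. *)
Lemma P_ring_right_coherent (R : nzRingType) :
  countable [set: R] -> P_ring R -> right_coherent R.
Proof.
move=> ctR /projective_dual_basis[phi [u phiK]] J [n [g JE]].
exists n, g; split=> //; rewrite -/(relations g).
have K0 : relations g 0 by rewrite /relations /= linear0.
have [e eE] := @countable_enum_rV R^c n (relations g) 0 ctR K0.
pose x i : Romega R := fun t => e t 0 i.
pose a i : R := g i.
have ax0 : \sum_i a i *: x i = 0.
  apply: Romega_ext => t; rewrite linear_sum linear0.
  have : relations g (e t) by rewrite eE; exists t.
  rewrite /relations /= => et; rewrite -[RHS]et /lincomb.
  by apply: eq_bigr => i _; rewrite linearZ.
have [ss uss ssP] : exists2 ss : seq {classic Romega R}, uniq ss &
    forall s i, s \notin ss -> fcoord s (phi (x i)) = 0.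
  have /choice[f fP] i : exists ss : seq {classic Romega R},
      forall s, s \notin ss -> fcoord s (phi (x i)) = 0.
    by have [ss _ ssP] := free_supp (phi (x i)); exists ss.
  exists (undup (flatten [seq f i | i <- enum 'I_n])); first exact: undup_uniq.
  move=> s i; rewrite mem_undup => nsf; apply: fP; apply: contra nsf => sf.
  by apply/flattenP; exists (f i) => //; apply: map_f; rewrite mem_enum.
pose d (j : 'I_(size ss)) : 'rV[R^c]_n :=
  \row_i fcoord (tnth (in_tuple ss) j) (phi (x i)).
have dK j : relations g (d j).
  rewrite /relations /=.
  have := congr1 (fun z => fcoord (tnth (in_tuple ss) j) (phi z)) ax0.
  rewrite !linear0 !linear_sum => <-; apply: eq_bigr => i _.
  by rewrite mxE !linearZ.
exists (size ss), d; apply/seteqP; split=> [k|_ [c _ <-]]; last first.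
  rewrite /relations /= linear_lincomb /lincomb big1// => j _ /=.
  by rewrite (dK j) scaler0.
rewrite eE => -[t _ <-].
exists (\row_j entry t (u (tnth (in_tuple ss) j))) => //.
apply/rowP => i; rewrite summxE.
have -> : e t 0 i = entry t (flift u (phi (x i))) by rewrite phiK.
rewrite (fliftE u uss (fun s => ssP s i)) linear_sum [RHS]big_tnth.
by apply: eq_bigr => j _; rewrite !mxE linearZ.
Qed.

(** * Absorption of summands and the free module of rank continuum *)

Section Iso.
Variable R : nzRingType.
Implicit Types A B C D F M P Q : lmodType R.

Lemma iso_intro A B (f : A -> B) (g : B -> A) :
  linear f -> cancel f g -> cancel g f -> module_iso A B.
Proof. by move=> linf fK gK; exists (linear_of linf), g. Qed.

Lemma iso_sym A B : module_iso A B -> module_iso B A.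
Proof.
move=> [f [g fK gK]]; apply: (@iso_intro _ _ g f) => // a x y.
by rewrite -[x in LHS]gK -[y in LHS]gK -linearP fK.
Qed.

Lemma iso_trans B A C : module_iso A B -> module_iso B C -> module_iso A C.
Proof. by move=> [f fbij] [g gbij]; exists (g \o f); apply: bij_comp. Qed.

Lemma iso_prod A B C D : module_iso A B -> module_iso C D ->
  module_iso (A * C)%type (B * D)%type.
Proof.
move=> [f [f' fK fK']] [g [g' gK gK']].
apply: (@iso_intro _ _ (fun p => (f p.1, g p.2)) (fun p => (f' p.1, g' p.2))).
- by move=> a x y; rewrite !linearP.
- by move=> [x y] /=; rewrite fK gK.
- by move=> [x y] /=; rewrite fK' gK'.
Qed.

Lemma iso_prodC A B : module_iso (A * B)%type (B * A)%type.
Proof.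
by apply: (@iso_intro _ _ (fun p => (p.2, p.1)) (fun p => (p.2, p.1))) => [a x y|[]|[]].
Qed.

Lemma iso_prodA A B C : module_iso (A * (B * C))%type (A * B * C)%type.
Proof.
by apply: (@iso_intro _ _ (fun p => (p.1, p.2.1, p.2.2))
  (fun p => (p.1.1, (p.1.2, p.2)))) => [a x y|[x []]|[[]]].
Qed.

Lemma iso_refl A : module_iso A A.
Proof. by apply: (@iso_intro _ _ id id). Qed.

Lemma iso_splitting A B (g : {linear A -> B}) (h : {linear B -> A}) :
  cancel h g -> module_iso A (B * kernel_mod g)%type.
Proof.
move=> hK.
have [k kE] : exists k : {linear A -> kernel_mod g}, forall x, kernel_val (k x) = x - h (g x).
  pose f : {linear A -> A} := idfun \- (h \o g).
  by apply: (@kernel_mod_corestrict _ _ _ _ g f) => x; rewrite linearB /= hK subrr.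
apply: (@iso_intro _ _ (fun x => (g x, k x)) (fun p => h p.1 + kernel_val p.2)).
- by move=> a x y; rewrite !linearP.
- by move=> x /=; rewrite kE addrC subrK.
- move=> [x y] /=; have gx : g (h x + kernel_val y) = x.
    by rewrite linearD hK kernel_valP addr0.
  by rewrite gx; congr pair; apply: kernel_val_inj; rewrite kE gx addrAC subrr add0r.
Qed.

Lemma iso_dirsum I A B : module_iso A B -> module_iso (dirsum I A) (dirsum I B).
Proof.
have map (C D : lmodType R) (f : {linear C -> D}) (c : dirsum I C) :
    exists d : dirsum I D, forall i, dcoord i d = f (dcoord i c).
  have fin : finite_set [set i | f (dcoord i c) <> 0].
    apply: sub_finite_set (dirsum_finite c) => i fi ci; apply: fi.
    by rewrite ci linear0.
  by exists (dirsum_of fin) => i; rewrite dcoord_dirsum_of.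
move=> iAB; have [f [f' fK fK']] := iAB.
have linf' : linear f' by move=> a x y; rewrite -[x in LHS]fK' -[y in LHS]fK' -linearP fK.
have [F FE] := choice (map _ _ f); have [G GE] := choice (map _ _ (linear_of linf')).
apply: (@iso_intro _ _ F G).
- by move=> a c d; apply: dirsum_ext => i; rewrite FE !linearP /= !FE.
- by move=> c; apply: dirsum_ext => i; rewrite GE FE /= fK.
- by move=> c; apply: dirsum_ext => i; rewrite FE GE /= fK'.
Qed.

Lemma iso_dirsum_reindex I J M (f : J -> I) : bijective f ->
  module_iso (dirsum I M) (dirsum J M).
Proof.
have reidx (I' J' : Type) (h : J' -> I') (c : dirsum I' M) : injective h ->
    exists d : dirsum J' M, forall j, dcoord j d = dcoord (h j) c.
  move=> hinj; have fin : finite_set [set j | dcoord (h j) c <> 0].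
    apply: (@finite_preimage _ _ [set i | dcoord i c <> 0] h); last exact: dirsum_finite.
    by move=> x y _ _; apply: hinj.
  by exists (dirsum_of fin) => i; rewrite dcoord_dirsum_of.
move=> [g fK gK].
have [F FE] := choice (fun c => reidx _ _ f c (can_inj fK)).
have [G GE] := choice (fun c => reidx _ _ g c (can_inj gK)).
apply: (@iso_intro _ _ F G).
- by move=> a c d; apply: dirsum_ext => i; rewrite FE !linearP /= !FE.
- by move=> c; apply: dirsum_ext => i; rewrite GE FE /= gK.
- by move=> c; apply: dirsum_ext => i; rewrite FE GE /= fK.
Qed.

Lemma iso_dirsum_curry I J M :
  module_iso (dirsum I (dirsum J M)) (dirsum (I * J) M).
Proof.
have unc (c : dirsum I (dirsum J M)) : exists d : dirsum (I * J) M,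
    forall p, dcoord p d = dcoord p.2 (dcoord p.1 c).
  have fin : finite_set [set p : I * J | dcoord p.2 (dcoord p.1 c) <> 0].
    apply: (@sub_finite_set _ _ (\bigcup_(i in [set i | dcoord i c <> 0])
        (pair i @` [set j | dcoord j (dcoord i c) <> 0]))).
      move=> [i j] /= cij; exists i => /=; last by exists j.
      by move=> ci; apply: cij; rewrite ci linear0.
    apply: bigcup_finite; first exact: dirsum_finite.
    by move=> i _; apply: finite_image; apply: dirsum_finite.
  by exists (dirsum_of fin) => i; rewrite dcoord_dirsum_of.
have cur (d : dirsum (I * J) M) : exists c : dirsum I (dirsum J M),
    forall i j, dcoord j (dcoord i c) = dcoord (i, j) d.
  have /choice[f fE] i : exists c : dirsum J M, forall j, dcoord j c = dcoord (i, j) d.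
    have fin : finite_set [set j | dcoord (i, j) d <> 0].
      apply: (@finite_preimage _ _ [set p | dcoord p d <> 0] (pair i)).
        by move=> x y _ _ [].
      exact: dirsum_finite.
    by exists (dirsum_of fin) => j; rewrite dcoord_dirsum_of.
  have fin : finite_set [set i | f i <> 0].
    apply: sub_finite_set (finite_image fst (dirsum_finite d)) => i fi /=.
    apply: contrapT => /forall2NP di; apply: fi; apply: dirsum_ext => j.
    rewrite fE linear0; apply: contrapT => dij.
    by case: (di (i, j)).
  by exists (dirsum_of fin) => i j; rewrite dcoord_dirsum_of fE.
have [F FE] := choice unc; have [G GE] := choice cur.
apply: (@iso_intro _ _ F G).
- by move=> a c d; apply: dirsum_ext => p; rewrite FE !linearP /= !FE.
- by move=> c; apply: dirsum_ext => i; apply: dirsum_ext => j; rewrite GE FE.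
- by move=> c; apply: dirsum_ext => -[i j]; rewrite FE GE.
Qed.

(** The shift moves only the components in A one step to the left, which frees the
    first of them: ((a_0, b_0), (a_1, b_1), ...) is sent to a_0 and
    ((a_1, b_0), (a_2, b_1), ...). *)
Lemma iso_dirsum_shift A B :
  module_iso (dirsum nat (A * B)%type) (A * dirsum nat (A * B)%type)%type.
Proof.
have sh (c : dirsum nat (A * B)%type) : exists d : dirsum nat (A * B)%type,
    forall n, dcoord n d = ((dcoord n.+1 c).1, (dcoord n c).2).
  have fin : finite_set [set n | ((dcoord n.+1 c).1, (dcoord n c).2) <> 0].
    apply: (@sub_finite_set _ _ ([set n | dcoord n c <> 0] `|`
        succn @^-1` [set n | dcoord n c <> 0])).
      move=> n /= cn; apply: contrapT => /not_orP[/contrapT c0 /contrapT c1].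
      by apply: cn; rewrite c0 c1.
    rewrite finite_setU; split; first exact: dirsum_finite.
    by apply: finite_preimage (dirsum_finite c) => x y _ _ [].
  by exists (dirsum_of fin) => n; rewrite dcoord_dirsum_of.
have un (p : A * dirsum nat (A * B)%type) : exists c : dirsum nat (A * B)%type,
    forall n, dcoord n c =
      ((if n is n'.+1 then (dcoord n' p.2).1 else p.1), (dcoord n p.2).2).
  have fin : finite_set [set n |
      ((if n is n'.+1 then (dcoord n' p.2).1 else p.1), (dcoord n p.2).2) <> 0].
    apply: (@sub_finite_set _ _ ([set 0%N] `|` [set n | dcoord n p.2 <> 0] `|`
        succn @` [set n | dcoord n p.2 <> 0])).
      move=> [|n] /= cn; first by left; left.
      apply: contrapT => /not_orP[/not_orP[_ /contrapT c0] c1].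
      apply: cn; rewrite c0; have [->//|c2] := pselect (dcoord n p.2 = 0).
      by case: c1; exists n.
    rewrite !finite_setU; split; first by split=> //; apply: dirsum_finite.
    by apply: finite_image; apply: dirsum_finite.
  by exists (dirsum_of fin) => n; rewrite dcoord_dirsum_of.
have [F FE] := choice sh; have [G GE] := choice un.
apply: (@iso_intro _ _ (fun c => ((dcoord 0 c).1, F c)) G).
- move=> a c d; congr pair.
  by apply: dirsum_ext => n; rewrite FE !linearP /= !FE.
- move=> c; apply: dirsum_ext => n; rewrite GE /=.
  by case: n => [|n]; rewrite !FE /= -surjective_pairing.
- move=> [x d] /=; congr pair; first by rewrite GE.
  by apply: dirsum_ext => n; rewrite FE !GE /= -surjective_pairing.
Qed.

(** The Eilenberg swindle: F is a direct sum of countably many copies of A x B,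
    and shifting the copies of A makes room for one more. *)
Lemma swindle F A B : module_iso F (A * B)%type -> module_iso (dirsum nat F) F ->
  module_iso (A * F)%type F.
Proof.
move=> FAB FF; have FG : module_iso F (dirsum nat (A * B)%type).
  by apply: (iso_trans (iso_sym FF)); apply: iso_dirsum.
apply: (iso_trans (iso_prod (iso_refl A) FG)).
by apply: iso_trans (iso_sym FG); apply/iso_sym/iso_dirsum_shift.
Qed.

(** P and F absorb each other: the swindle gives P x F = F and F x F = F,
    and P = F x P' = F x F x P' = P x F. *)
Lemma mutual_summands_iso F P (P' : lmodType R) Q : module_iso (dirsum nat F) F ->
  module_iso P (F * P')%type -> module_iso F (P * Q)%type -> module_iso P F.
Proof.
move=> FF PF FP; have PFF := swindle FP FF.
have FFF : module_iso (F * F)%type F.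
  apply: (@swindle F F (P' * Q)%type) => //; apply: (iso_trans FP).
  apply: (iso_trans (iso_prod PF (iso_refl Q))).
  exact/iso_sym/iso_prodA.
apply: iso_trans PFF; apply: (iso_trans PF).
apply: (iso_trans (iso_prod (iso_sym FFF) (iso_refl P'))).
apply: (iso_trans (iso_sym (iso_prodA F F P'))).
apply: (iso_trans (iso_prodC F (F * P')%type)).
exact: iso_prod (iso_sym PF) (iso_refl F).
Qed.

End Iso.

Lemma nat_prod_continuum :
  exists f : (nat -> bool) -> nat * (nat -> bool), bijective f.
Proof.
have : ([set: nat * (nat -> bool)] #= [set: nat -> bool])%card.
  apply: Cantor_Bernstein; apply/pcard_injP.
    exists (fun p k => if odd k then k./2 == p.1 else p.2 k./2).
    move=> [n a] [m b] _ _ hE; congr pair.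
      have := congr1 (fun g => g n.*2.+1) hE.
      by rewrite /= odd_double /= uphalf_double eqxx => /esym/eqP.
    apply: funext => k; have := congr1 (fun g => g k.*2) hE.
    by rewrite /= odd_double doubleK.
  by exists (pair 0%N) => a b _ _ [].
by rewrite card_eq_sym => /card_set_bijP[f]; rewrite setTT_bijective; exists f.
Qed.

Section Continuum.
Variable R : nzRingType.
Let F := dirsum (nat -> bool) R^o.

Lemma free_continuum_absorbs : module_iso (dirsum nat F) F.
Proof.
apply: (iso_trans (iso_dirsum_curry _ _ _)).
have [f fbij] := nat_prod_continuum.
exact: iso_dirsum_reindex fbij.
Qed.

(** A sequence in a countable ring is coded by the indicator of its graph. *)
Lemma Romega_quotient_free : countable [set: R] ->
  exists w : (nat -> bool) -> Romega R, forall y, exists a, w a = y.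
Proof.
move=> /countable_injP[c cinj].
have {}cinj : injective c by move=> a b; apply: cinj; rewrite in_setT.
pose code (y : Romega R) (k : nat) : bool :=
  if unpickle k is Some p then c (y p.1) == p.2 :> nat else false.
have code_inj : injective code.
  move=> y z yz; apply: funext => n; apply: cinj.
  have := congr1 (fun g => g (pickle (n, c (y n)))) yz.
  by rewrite /code pickleK /= eqxx => /esym/eqP.
have /choice[w wP] a : exists y, forall z, code z = a -> y = z.
  have [[y ya]|ny] := pselect (exists y, code y = a).
    by exists y => z za; apply: code_inj; rewrite ya.
  by exists 0 => z za; case: ny; exists z.
by exists w => y; exists (code y); apply: wP.
Qed.

(** The indicator of the branch [a] of the binary tree, whose nodes are the
    finite binary words, numbered by [pickle]. *)
Definition branch (a : nat -> bool) : Romega R :=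
  fun t => if unpickle t is Some s then ((s : seq bool) == mkseq a (size s))%:R else 0.

(** Distinct branches part at some level, so far enough along one branch all of
    finitely many others are absent. *)
Lemma branch_separated (a : nat -> bool) (s : seq {classic nat -> bool}) :
  exists t, entry t (branch a) = 1 /\
    forall b : {classic nat -> bool}, b \in s -> b <> a ->
      entry t (branch b) = 0.
Proof.
have [k kP] : exists k, forall n, (k <= n)%N ->
    forall b : {classic nat -> bool}, b \in s -> b <> a -> mkseq a n <> mkseq b n.
  elim: s => [|b0 s [k kP]]; first by exists 0%N.
  have [b0a|ba] := pselect (b0 = a).
    exists k => n kn b; rewrite inE => /predU1P[-> //|bs]; exact: kP.
  have [i bi] : exists i, b0 i <> a i.
    by apply: contrapT => /forallNP e; apply: ba; apply: funext => i; apply: contrapT.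
  exists (maxn k i.+1) => n; rewrite geq_max => /andP[kn ni] b.
  rewrite inE => /predU1P[-> _|bs]; last exact: kP.
  by move=> /(congr1 (fun q => nth true q i)); rewrite !nth_mkseq// => /esym.
exists (pickle (mkseq a k)); rewrite /entry /branch pickleK size_mkseq eqxx.
split=> // b bs ba; case: eqP => // ab.
by case: (kP k (leqnn k) b bs ba).
Qed.

Lemma branch_independent (c : F) :
  radM (flift branch c) -> forall a, jrad (fcoord a c).
Proof.
move=> radc a; have [s us sc] := free_supp c.
have [as_|/sc ->] := boolP ((a : {classic nat -> bool}) \in s); last exact: jrad0.
have [t [ta tb]] := branch_separated a s.
have -> : fcoord a c = entry t (flift branch c).
  rewrite (fliftE _ us sc) linear_sum (bigD1_seq (a : {classic nat -> bool}))//=.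
  rewrite linearZ /= ta mulr1 big_seq_cond big1 ?addr0// => b /andP[bs /eqP ba].
  by rewrite linearZ /= tb// mulr0.
apply: (radc [set y | jrad (entry t y)]) => [|j y radj] /=.
  split=> [|b y z yt zt] /=; first by rewrite linear0; apply: jrad0.
  by rewrite linearP; apply: jradD => //; apply: jradMl.
by rewrite linearZ; apply: jradMr.
Qed.

(** Complete the branches to a generating family of R^omega by vectors [u i]
    independent modulo the radical and the span of the branches.  This presents
    R^omega as a quotient of a free module F x F'; a section h followed by the
    projection to F sends a combination of branches to its coefficients
    modulo JF, hence is onto by Nakayama's lemma. *)
Lemma free_quotient_Romega : dcc_principal_right R -> P_ring R ->
  exists theta : {linear Romega R -> F}, forall c, exists y, theta y = c.
Proof.
move=> dccR projR; have Tnil := dcc_Tnilpotent dccR.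
pose N : set (Romega R) := [set z | exists c, radM (z - flift branch c)].
have sN : submodule N.
  split=> [|a y z [c yc] [d zd]].
    by exists 0; rewrite (linear0 (flift branch)) subr0; apply: submodule0 (radM_submodule _).
  exists (a *: c + d); rewrite (linearP (flift branch)) opprD addrACA -scalerBr.
  by case: (radM_submodule (Romega R)) => _; apply.
have jN j m : jrad j -> N (j *: m).
  by move=> radj; exists 0; rewrite (linear0 (flift branch)) subr0; apply: radM_scale.
have [I [e [u [_ eu ind spn]]]] := top_basis dccR sN jN.
pose g (p : F * dirsum I R^o) := flift branch p.1 + flift u p.2.
have ling : linear g.
  by move=> a p q; rewrite /g !linearP scalerDr addrACA.
have gonto y : exists p, linear_of ling p = y.
  have [||p _ <-] := nakayama (N := range (linear_of ling)) Tnil _ _ y.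
  - exact: submodule_range.
  - move=> z; have [d [c cd]] := spn z; exists (g (c, d)); split; first by exists (c, d).
    by rewrite /g /= (addrC (flift branch c)) opprD addrA.
  - by exists p.
have [h hK] := projective_split projR gonto.
have linf : linear (fun y => (h y).1) by move=> a y z; rewrite linearP.
exists (linear_of linf).
move=> c; have [||y _ yc] := nakayama (N := range (linear_of linf)) Tnil _ _ c.
- exact: submodule_range.
- move=> {}c; exists (h (flift branch c)).1; split; first by exists (flift branch c).
  have := hK (flift branch c); case: (h _) => r d; rewrite /= /g /= => hE.
  have ud : flift u d = flift branch (c - r).
    by rewrite (linearB (flift branch)) /= -hE addrAC subrr add0r.
  suff : radM (flift branch (c - r)) by move/branch_independent/fcoord_radM.
  rewrite -ud.
  apply: (@flift_submodule R I (Romega R) (@radM R (Romega R))) => [|i].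
    exact: radM_submodule.
  rewrite -eu scalerA; apply: radM_scale; apply: ind.
  by exists (c - r); rewrite ud subrr; apply: submodule0 (radM_submodule _).
- by exists y.
Qed.

Lemma Romega_iso_free : countable [set: R] -> dcc_principal_right R ->
  P_ring R -> module_iso (Romega R) F.
Proof.
move=> ctR dccR projR.
have projF : projective F.
  by apply: free_projective; exists (nat -> bool); apply: iso_refl.
have [theta /(projective_split projF)[h hK]] := free_quotient_Romega dccR projR.
have [w wonto] := Romega_quotient_free ctR.
have [y|k kK] := projective_split (g := flift w) projR.
  by have [a <-] := wonto y; exists (delta R a); rewrite /= flift_delta.
exact: (mutual_summands_iso free_continuum_absorbs (iso_splitting hK) (iso_splitting kK)).
Qed.

End Continuum.

(** * Quotient modules *)

Section Quotient.
Variable R : nzRingType.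

(** The boolean form of N; the proof of closure is an argument so that the
    closure instance can be inferred. *)
Definition submodule_pred (M : lmodType R) (N : set M) of submodule N :
  {pred M} := fun x => `[< N x >].

Lemma submodule_pred_zmod_closed (M : lmodType R) (N : set M) (sN : submodule N) :
  zmod_closed (submodule_pred sN).
Proof.
split=> [|x y /asboolP Nx /asboolP Ny]; apply/asboolP; first exact: submodule0.
exact: submoduleB.
Qed.

HB.instance Definition _ (M : lmodType R) (N : set M) (sN : submodule N) :=
  GRing.isZmodClosed.Build M (submodule_pred sN) (submodule_pred_zmod_closed sN).

Definition quotient_mod (M : lmodType R) (N : set M) (sN : submodule N) : Type :=
  (Quotient.quot (submodule_pred sN)).

HB.instance Definition _ (M : lmodType R) (N : set M) (sN : submodule N) :=
  GRing.Zmodule.on (quotient_mod sN).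

Section Scale.
Variables (M : lmodType R) (N : set M) (sN : submodule N).
Let Q := quotient_mod sN.

Definition quotient_proj (x : M) : Q := \pi_(Quotient.quot (submodule_pred sN))%qT x.

Lemma quotient_projE x y : (quotient_proj x = quotient_proj y) <-> N (x - y).
Proof.
have -> : N (x - y) <-> x - y \in submodule_pred sN.
  by split=> [h|/asboolP//]; apply/asboolP.
rewrite Quotient.idealrBE; split=> [|/eqP//].
by move=> e; apply/eqP.
Qed.

Lemma quotient_projD : {morph quotient_proj : x y / x + y}.
Proof. exact: Quotient.pi_add. Qed.

Lemma quotient_proj_surj (y : Q) : exists x, quotient_proj x = y.
Proof. by exists (repr (y : Quotient.quot (submodule_pred sN))); rewrite /quotient_proj reprK. Qed.

Definition qscale (a : R) (y : Q) : Q :=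
  quotient_proj (a *: repr (y : Quotient.quot (submodule_pred sN))).

Lemma qscale_quotient_proj a x : qscale a (quotient_proj x) = quotient_proj (a *: x).
Proof.
apply/quotient_projE; rewrite -scalerBr; apply: submoduleZ => //.
apply/quotient_projE.
by rewrite /quotient_proj reprK.
Qed.

Lemma qscaleA a b v : qscale a (qscale b v) = qscale (a * b) v.
Proof. by have [x <-] := quotient_proj_surj v; rewrite !qscale_quotient_proj scalerA. Qed.
Lemma qscale1 : left_id 1 qscale.
Proof. by move=> v; have [x <-] := quotient_proj_surj v; rewrite !qscale_quotient_proj scale1r. Qed.
Lemma qscaleDr : right_distributive qscale +%R.
Proof.
move=> a v w; have [x <-] := quotient_proj_surj v; have [y <-] := quotient_proj_surj w.
by rewrite -quotient_projD !qscale_quotient_proj -quotient_projD scalerDr.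
Qed.
Lemma qscaleDl v : {morph qscale^~ v : a b / a + b}.
Proof.
by move=> a b; have [x <-] := quotient_proj_surj v; rewrite !qscale_quotient_proj -quotient_projD scalerDl.
Qed.

End Scale.

HB.instance Definition _ (M : lmodType R) (N : set M) (sN : submodule N) :=
  GRing.Zmodule_isLmodule.Build R (quotient_mod sN)
    (@qscaleA M N sN) (@qscale1 M N sN) (@qscaleDr M N sN) (@qscaleDl M N sN).

Lemma quotient_exists (M : lmodType R) (N : set M) : submodule N ->
  exists (Q : lmodType R) (q : {linear M -> Q}),
    (forall y, exists x, q x = y) /\ forall x, q x = 0 <-> N x.
Proof.
move=> sN; have linq : linear (quotient_proj sN).
  by move=> a x y; rewrite quotient_projD -qscale_quotient_proj.
exists (quotient_mod sN), (linear_of linq); split=> [|x]; first exact: quotient_proj_surj.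
rewrite -[N x]/(N (id x)) -[x in N x]subr0 -(quotient_projE sN x 0).
by have -> : quotient_proj sN 0 = 0 by exact: (linear0 (linear_of linq)).
Qed.

End Quotient.

(** * T-nilpotence of the radical of a perfect ring *)

Section PerfectRadical.
Variable R : nzRingType.
Implicit Types M P Q : lmodType R.

(** Nakayama's lemma for the right ideal generated by finitely many a_i: in
    a = a C with C over J, the entry 1 - c_kk is invertible, so a_k can be
    eliminated; the new matrix is still over J. *)
Lemma right_nakayama (I : eqType) (s : seq I) (a : I -> R) (c : I -> I -> R) :
  (forall i j, jrad (c i j)) ->
  (forall j, j \in s -> a j = \sum_(i <- s) a i * c i j) ->
  forall j, j \in s -> a j = 0.
Proof.
elim: s c => // k s IHs c radc ac.
have [v [_ vk]] := jrad_inv (radc k k).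
have ak : a k = \sum_(i <- s) a i * (c i k * v).
  have := ac k (mem_head _ _); rewrite big_cons => /eqP.
  rewrite addrC -subr_eq -[X in X - _]mulr1 -mulrBr => /eqP /(congr1 (fun x => x * v)).
  rewrite -mulrA vk mulr1 => ->; rewrite mulr_suml.
  by apply: eq_bigr => i _; rewrite mulrA.
have as0 : forall j, j \in s -> a j = 0.
  apply: (IHs (fun i j => c i k * v * c k j + c i j)) => [i j|j js].
    by apply: jradD => //; apply: jradMl.
  rewrite ac ?inE ?js ?orbT// big_cons ak mulr_suml -big_split /=.
  by apply: eq_bigr => i _; rewrite mulrDr !mulrA.
move=> j; rewrite inE => /predU1P[->|/as0//].
by rewrite ak big_seq big1// => i /as0 ->; rewrite mul0r.
Qed.

(** The coordinates a_j of y satisfy a_j = sum of the a_i c_ij, where c_ij is the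
    j-th coordinate of the i-th dual basis vector, which lies in J. *)
Lemma projective_rad_eq0 P : projective P -> (forall y : P, radM y) ->
  forall y : P, y = 0.
Proof.
move=> /projective_dual_basis[phi [u phiK]] radP y.
rewrite -(phiK y); have -> : phi y = 0; last by rewrite (linear0 (flift u)).
have [s us sy] := free_supp (phi y); apply: free_ext => j; rewrite linear0.
have [js|/sy//] := boolP ((j : {classic P}) \in s).
apply: (@right_nakayama {classic P} s (fun i => fcoord i (phi y))
  (fun i j => fcoord j (phi (u i)))) js => [i k|k _].
  apply: radM_fcoord; apply: (radM_linear phi); exact: radP.
rewrite -[in LHS](phiK y) (fliftE u us sy) !linear_sum.
by apply: eq_bigr => i _; rewrite !linearZ.
Qed.

Lemma radM_surj M Q (p : {linear M -> Q}) : (forall y, exists x, p x = y) ->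
  forall z, radM z -> exists x, radM x /\ p x = z.
Proof.
move=> ponto z /(_ [set z | exists x, radM x /\ p x = z]); apply => [|j y radj].
  split=> [|a _ _ [x [radx <-]] [y [rady <-]]].
    by exists 0; rewrite linear0; split=> //; apply: submodule0 (radM_submodule _).
  exists (a *: x + y); rewrite linearP; split=> //.
  by case: (radM_submodule M) => _; apply.
have [x <-] := ponto y; exists (j *: x); rewrite linearZ; split=> //.
exact: radM_scale.
Qed.

(** If M = JM and P is a projective cover of M, then JP together with the
    superfluous kernel is P, so that P = JP and P = 0. *)
Lemma left_perfect_radical M : left_perfect R -> (forall x : M, radM x) ->
  forall x : M, x = 0.
Proof.
move=> /(_ M)[P [p [projP ponto supK]]] radMx x.
have radP (y : P) : radM y.
  pose N : {pred P} := fun y => `[< radM y >].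
  suff : y \in N by move/asboolP.
  apply: supK => [|z].
    split=> [|a v w /asboolP radv /asboolP radw]; apply/asboolP.
      exact: submodule0 (radM_submodule _).
    by case: (radM_submodule P) => _; apply.
  have [v [radv vz]] := radM_surj ponto (radMx (p z)).
  exists v, (z - v); split; first exact/asboolP.
    by rewrite /= linearB vz subrr.
  by rewrite addrC subrK.
have [y <-] := ponto x.
by rewrite (projective_rad_eq0 projP radP y) linear0.
Qed.

(** Let M be the direct limit of R -a_0-> R -a_1-> ..., with f in the free
    module on nat representing the sum of the images of its coordinates;
    [sig n f] is that sum pushed to stage n, for the coordinates up to n.  Shifting
    coordinates by multiplication by a_n does not change the class, so M = JM and
    M = 0.  The vanishing of the class of the first basis vector says that
    a product of the a_i is zero. *)
Lemma left_perfect_Tnilpotent : left_perfect R -> rad_Tnilpotent R.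
Proof.
move=> perf a rada; pose F := dirsum nat R^o.
pose sig := fix sig n (f : F) : R :=
  if n is m.+1 then sig m f * a m + fcoord m.+1 f else fcoord 0%N f.
have sigP n : scalar (sig n).
  elim: n => [|n IHn] b f g /=; first by rewrite linearP.
  by rewrite IHn linearP mulrDl mulrDr mulrA addrACA.
pose G : set F := [set f | exists n, forall m, (n <= m)%N -> sig m f = 0].
have sG : submodule G.
  split=> [|b f g [n fn] [k gk]].
    exists 0%N => m _; have := sigP m (- 1) 0 0.
    by rewrite scaler0 addr0 mulN1r addNr.
  exists (maxn n k) => m; rewrite geq_max => /andP[nm km].
  by rewrite sigP fn// gk// mulr0 addr0.
have [Q [q [qonto qG]]] := quotient_exists sG.
have radQ (y : Q) : radM y.
  have [f <-] := qonto y.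
  have fin : finite_set [set n | (if n is m.+1 then fcoord m f * a m else 0) <> 0].
    apply: sub_finite_set (finite_image succn (free_finite f)) => -[|n] //= fn.
    by exists n => // fn0; apply: fn; rewrite fn0 mul0r.
  pose g : F := free_of fin.
  have -> : q f = q g.
    apply/eqP; rewrite -subr_eq0 -linearB; apply/eqP/qG.
    have [s _ sf] := free_supp f.
    have sg m : sig m.+1 g = sig m f * a m.
      elim: m => [|m IHm]; first by rewrite /= !fcoord_free_of mul0r add0r.
      rewrite [LHS]/= -/(sig m.+1 g) IHm fcoord_free_of [sig m.+1 f]/=.
      by rewrite mulrDl.
    exists (\max_(i <- s) i).+1 => -[//|m] mm.
    rewrite -[f - g]addrC -scaleN1r sigP sg /= mulN1r.
    rewrite [fcoord m.+1 f]sf ?addr0 ?addNr//.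
    apply/negP => ms; have := @leq_bigmax_seq {classic nat} s xpredT (fun i => i : nat) m.+1 ms isT => /=.
    by rewrite leqNgt mm.
  apply: (radM_linear q); apply: fcoord_radM => -[|n]; rewrite fcoord_free_of.
    exact: jrad0.
  exact: jradMl.
have /qG[n /(_ _ (leqnn n)) s0] : q (delta R 0%N) = 0.
  exact: left_perfect_radical.
exists n; rewrite -s0 => {s0}; elim: n => [|n IHn].
  by rewrite big_ord0 /= deltaE eqxx.
by rewrite big_ord_recr /= IHn deltaE; case: eqP => // _; rewrite addr0.
Qed.

(** With x = f k, the preimage of R (1 - r x) together with K is P, so it
    is P; applied to r k this shows that r x is in R (1 - r x), hence so is 1. *)
Lemma superfluous_jrad P (K : set P) (f : {linear P -> R^o}) k :
  superfluous K -> submodule K -> K k -> jrad (f k).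
Proof.
move=> supK sK Kk r; set x : R := f k.
pose N : {pred P} := fun y => `[< exists u, (f y : R) = u * (1 - r * x) >].
have NP y : y \in N.
  apply: supK => [|z].
    split=> [|a v w /asboolP[b vb] /asboolP[c wc]]; apply/asboolP.
      by exists 0; rewrite linear0 mul0r.
    by exists (a * b + c); rewrite mulrDl -mulrA -vb -wc linearP.
  pose t : R := f z; exists (z - (t * r) *: k), ((t * r) *: k); split.
  - apply/asboolP; exists t; rewrite mulrBr mulr1 [t * (r * x)]mulrA.
    by rewrite linearB linearZ.
  - exact: submoduleZ.
  - by rewrite subrK.
have /asboolP[u] := NP (r *: k); rewrite linearZ => uE.
have {}uE : r * x = u * (1 - r * x) by exact: uE.
by exists (1 + u); rewrite mulrDl mul1r -uE subrK.
Qed.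

End PerfectRadical.

(** * Projectivity over perfect coherent rings *)

Section PerfectCoherent.
Variables (R : nzRingType) (P : lmodType R) (p : {linear P -> Romega R}).
Hypotheses (cohR : right_coherent R) (ponto : forall y, exists x, p x = y).
Variables (I : Type) (phi : {linear P -> dirsum I R^o}) (u : I -> P).
Hypothesis phiK : cancel phi (flift u).

(** The equational criterion for flatness.  Write k as the sum of the a_i v_i with
    a_i the coordinates of k; at each index the values of the p v_i form a
    relation of the a_i.  Finitely many relations d_j generate them, so
    p v_i is a sum of d_ji y_j with y_j in R^omega.  Lift y_j to z_j: then
    v_i - sum of d_ji z_j is in the kernel and can replace v_i in
    the expansion of k. *)
Lemma kernel_pure (k : P) (s : seq {classic I}) : p k = 0 -> uniq s ->
  (forall i, i \notin s -> fcoord i (phi k) = 0) ->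
  exists k' : 'I_(size s) -> P, (forall i, p (k' i) = 0) /\
    k = \sum_i fcoord (tnth (in_tuple s) i) (phi k) *: k' i.
Proof.
move=> pk us sk; pose v i := u (tnth (in_tuple s) i).
pose a i : (R^c)^o := fcoord (tnth (in_tuple s) i) (phi k).
have kE : k = \sum_i (a i : R) *: v i.
  by rewrite -[LHS]phiK (fliftE u us sk) big_tnth.
have [m [d dE]] := right_coherent_relations a cohR.
pose c t : 'rV[R^c]_(size s) := \row_i entry t (p (v i)).
have /choice[l lE] t : exists b, lincomb d b = c t.
  have : relations a (c t).
    rewrite /relations /=.
    have := congr1 (entry t) pk; rewrite kE !linear_sum linear0 => et.
    rewrite -[RHS]et /lincomb; apply: eq_bigr => i _.
    by rewrite mxE !linearZ.
  by rewrite dE => -[b _]; exists b.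
have /choice[z zE] (j : 'I_m) : exists z, p z = (fun t => l t 0 j) :> Romega R.
  exact: ponto.
pose dd j i : R := d j 0 i.
exists (fun i => v i - \sum_j dd j i *: z j); split=> [i|].
  apply: Romega_ext => t; rewrite linearB linear_sum linearB linear_sum linear0.
  apply/eqP; rewrite subr_eq0; apply/eqP.
  have := congr1 (fun b : 'rV[R^c]_(size s) => b 0 i) (lE t); rewrite mxE => e.
  apply: etrans (esym e) _; rewrite /lincomb summxE; apply: eq_bigr => j _.
  by rewrite mxE !linearZ /= zE.
rewrite {1}kE; under [RHS]eq_bigr do rewrite scalerBr.
rewrite sumrB -[LHS]subr0; congr (_ - _).
under eq_bigr do rewrite scaler_sumr.
rewrite exchange_big big1 //= => j _.
under eq_bigr do rewrite scalerA.
rewrite -scaler_suml.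
have : relations a (d j) by rewrite dE; apply: range_lincomb.
rewrite /relations /= => dj.
rewrite (_ : \sum_i _ = 0) ?scale0r//.
Qed.

End PerfectCoherent.

Lemma perfect_coherent_P_ring (R : nzRingType) :
  left_perfect R -> right_coherent R -> P_ring R.
Proof.
move=> perfR cohR; have Tnil := left_perfect_Tnilpotent perfR.
have [P [p [projP ponto supK]]] := perfR (Romega R).
have [phi [u phiK]] := projective_dual_basis projP.
have sK : submodule [set x | p x = 0].
  by split=> [|a x y /= px py]; rewrite /= ?linear0// linearP px py scaler0 addr0.
have radK (x : kernel_mod p) : radM x.
  have px := kernel_valP x; have [s us sx] := free_supp (phi (kernel_val x)).
  have [k' [pk' xE]] := kernel_pure cohR ponto phiK px us sx.
  have /choice[k kE] i : exists k : kernel_mod p, kernel_val k = k' i.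
    exact: kernel_mod_lift.
  have -> : x = \sum_i fcoord (tnth (in_tuple s) i) (phi (kernel_val x)) *: k i.
    apply: kernel_val_inj; rewrite {1}xE linear_sum; apply: eq_bigr => i _.
    by rewrite linearZ /= kE.
  apply: submodule_sum => [|i _]; first exact: radM_submodule.
  apply: radM_scale.
  exact: (superfluous_jrad (@dcoord R _ R^o _ \o phi) supK sK px).
have K0 (x : P) : p x = 0 -> x = 0.
  move=> /kernel_mod_lift[k <-].
  have -> // : k = 0.
  apply: (@nakayama R _ [set y | y = 0]) => // [|y].
    by split=> // b y z -> ->; rewrite scaler0 addr0.
  by exists 0; split=> //; apply: radK.
have pinj : injective p.
  move=> x y pxy; apply/eqP; rewrite -subr_eq0; apply/eqP/K0.
  by rewrite linearB pxy subrr.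
have [h hK] := choice ponto.
have linh : linear h by move=> a x y; apply: pinj; rewrite linearP !hK.
apply: (@retract_projective R _ (Romega R) (phi \o linear_of linh) (p \o flift u)).
by move=> y; rewrite /= phiK hK.
Qed.

(** * The equivalence over countable rings *)

(* [nat -> bool] has cardinality 2^aleph_0. *)
Theorem corollary6p7 (R : nzRingType) (countableR : countable [set: R]) :
  [/\ (F_ring R <-> P_ring R),
      (P_ring R <-> left_perfect R /\ right_coherent R)
    & (F_ring R -> module_iso (Romega R) (dirsum (nat -> bool) R^o))].
Proof.
have iso : P_ring R -> module_iso (Romega R) (dirsum (nat -> bool) R^o).
  by move=> projR; apply: Romega_iso_free => //; apply: P_ring_dcc.
split; last by move=> /free_projective/iso.
  by split=> [/free_projective//|/iso]; exists (nat -> bool).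
split=> [projR|[perfR cohR]]; last exact: perfect_coherent_P_ring.
split; last exact: P_ring_right_coherent.
exact/dcc_left_perfect/P_ring_dcc.
Qed.
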